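(* There exist positive numbers $c$ and $\epsilon_0$ and unit vectors $\hat{v}^{(1)},\dots,\hat{v}^{(7)}\in\mathbb{R}^3$ with the following property. Let $\hat{\mathcal{U}}$ be any single-qubit unitary channel and let $\epsilon\in(0,\epsilon_0]$. Let $\hat{\mathcal{U}}_1,\dots,\hat{\mathcal{U}}_7$ be single-qubit unitary channels satisfying $$\tfrac12\big[\mathcal{J}(\hat{\mathcal{U}}_j\circ\hat{\mathcal{U}}^{-1})\big]_{MB}=\hat e^{(j)}\hat e^{(j)T},\qquad \hat e^{(j)}=\begin{pmatrix}\sqrt{1-(c\epsilon)^2}\\ c\epsilon\,\hat v^{(j)}\end{pmatrix}\in\mathbb{R}^4,$$ and let $\mathcal{U}_1,\dots,\mathcal{U}_7$ be any single-qubit unitary channels with $\tfrac12\|\hat{\mathcal{U}}_j-\mathcal{U}_j\|_\diamond\le\epsilon$ for all $j$. Then there exists a probability distribution $(p_j)_{j=1}^7$ such that the remnant error $\mathcal{E}_{\rm rem}=\big(\sum_j p_j\mathcal{U}_j\big)\circ\hat{\mathcal{U}}^{-1}$ is a Pauli channel, i.e. $\mathcal{E}_{\rm rem}(\rho)=\sum_{a\in\{I,X,Y,Z\}}\chi_{aa}P_a\rho P_a$ with $\chi_{aa}\ge0$. Moreover, for the probability distribution $p$ that minimizes $\tfrac12\|\hat{\mathcal{U}}-\sum_j p_j\mathcal{U}_j\|_\diamond$ among all probability distributions on $\{1,\dots,7\}$ for which $\mathcal{E}_{\rm rem}$ is a Pauli channel, $$((c-1)\epsilon)^2\le \tfrac12\Big\|\hat{\mathcal{U}}-\sum_{j=1}^7p_j\mathcal{U}_j\Big\|_\diamond\le((c+1)\epsilon)^2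 .$$
   Context: A single-qubit unitary channel is $\mathcal{U}(\rho)=U\rho U^\dagger$ with $U\in U(2)$. $\|\cdot\|_\diamond$ is the diamond norm. For a linear map $\Phi$ on $2\times2$ matrices, the Choi operator is $\mathcal{J}(\Phi)=(\mathrm{Id}\otimes\Phi)(|\Omega\rangle\langle\Omega|)$ with the unnormalized $|\Omega\rangle=|00\rangle+|11\rangle$. The magic basis is $|\Psi_1\rangle=\frac{1}{\sqrt2}(|00\rangle+|11\rangle)$, $|\Psi_2\rangle=\frac{i}{\sqrt2}(|00\rangle-|11\rangle)$, $|\Psi_3\rangle=\frac{i}{\sqrt2}(|01\rangle+|10\rangle)$, $|\Psi_4\rangle=\frac{1}{\sqrt2}(|01\rangle-|10\rangle)$, and $[A]_{MB}$ denotes the $4\times4$ matrix with entries $([A]_{MB})_{ij}=\langle\Psi_i|A|\Psi_j\rangle$. For every single-qubit unitary channel $\mathcal{U}$ one has $\tfrac12[\mathcal{J}(\mathcal{U})]_{MB}=rr^T$ for a real unit vector $r\in\mathbb{R}^4$. $P_I=I,P_X=X,P_Y=Y,P_Z=Z$ are the Pauli matrices. *)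

(* Defs.v *)
From HB Require Import structures.
From mathcomp Require Import all_boot all_order all_algebra.
From mathcomp Require Import complex.
From mathcomp Require Import classical_sets reals.
From mathcomp Require Import Rstruct.
From Stdlib Require Rdefinitions.

Set Implicit Arguments.
Unset Strict Implicit.
Unset Printing Implicit Defensive.

Import Order.TTheory GRing.Theory Num.Theory.
Import ComplexField.
Local Open Scope ring_scope.
Local Open Scope classical_set_scope.
Local Open Scope complex_scope.

Notation RR := Rdefinitions.R.
Notation C := (RR[i]).

Definition cabs (z : C) : RR := let: a +i* b := z in Num.sqrt (a ^+ 2 + b ^+ 2).

Definition adj (n m : nat) (A : 'M[C]_(n, m)) : 'M[C]_(m, n) := (map_mx conjc A)^T.

Definition unitary (n : nat) (U : 'M[C]_n) : Prop := U *m adj U = 1%:M.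

Definition qmap := 'M[C]_2 -> 'M[C]_2.

Definition uchan (U : 'M[C]_2) : qmap := fun rho => U *m rho *m adj U.

Definition qcomp (F G : qmap) : qmap := fun rho => F (G rho).
Definition qsub (F G : qmap) : qmap := fun rho => F rho - G rho.
Definition qmix (p : 'I_7 -> RR) (Us : 'I_7 -> 'M[C]_2) : qmap :=
  fun rho => \sum_(j < 7) (p j)%:C *: uchan (Us j) rho.

(* two-qubit index: |a b> has index 2a+b *)
Definition tidx (a b : 'I_2) : 'I_4 := inord (2 * a + b).
Definition hi (i : 'I_4) : 'I_2 := inord (i %/ 2).
Definition lo (i : 'I_4) : 'I_2 := inord (i %% 2).

(* (Id (x) Phi)(X) for X an operator on C^2 (x) C^2 *)
Definition idtensor (Phi : qmap) (X : 'M[C]_4) : 'M[C]_4 :=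
  \matrix_(i, j)
    (Phi (\matrix_(b, b') X (tidx (hi i) b) (tidx (hi j) b'))) (lo i) (lo j).

(* unnormalized maximally entangled vector |00> + |11> *)
Definition Omega : 'cV[C]_4 := \col_(i < 4) nth 0 [:: 1; 0; 0; 1] i.

Definition choi (Phi : qmap) : 'M[C]_4 := idtensor Phi (Omega *m adj Omega).

Definition isq2 : C := ((Num.sqrt (2 : RR))^-1)%:C.
Definition magic (k : 'I_4) : 'cV[C]_4 :=
  match val k with
  | 0 => isq2 *: \col_(i < 4) nth 0 [:: 1; 0; 0; 1] i
  | 1 => (isq2 * 'i) *: \col_(i < 4) nth 0 [:: 1; 0; 0; -1] i
  | 2 => (isq2 * 'i) *: \col_(i < 4) nth 0 [:: 0; 1; 1; 0] i
  | _ => isq2 *: \col_(i < 4) nth 0 [:: 0; 1; -1; 0] i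
  end.

Definition toMB (A : 'M[C]_4) : 'M[C]_4 :=
  \matrix_(i, j) (adj (magic i) *m A *m magic j) 0 0.

Definition trnorm (n : nat) (A : 'M[C]_n) : RR :=
  sup [set x | exists V : 'M[C]_n, unitary V /\ x = cabs (\tr (V *m A))].

Definition dnorm (Phi : qmap) : RR :=
  sup [set x | exists X : 'M[C]_4, trnorm X <= 1 /\ x = trnorm (idtensor Phi X)].

Definition pauli (a : 'I_4) : 'M[C]_2 :=
  match val a with
  | 0 => 1%:M
  | 1 => \matrix_(i < 2, j < 2) nth 0 (nth [::] [:: [:: 0; 1]; [:: 1; 0]] i) j
  | 2 => \matrix_(i < 2, j < 2) nth 0 (nth [::] [:: [:: 0; - 'i]; [:: 'i; 0]] i) j
  | _ => \matrix_(i < 2, j < 2) nth 0 (nth [::] [:: [:: 1; 0]; [:: 0; -1]] i) j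
  end.

Definition is_pauli_channel (E : qmap) : Prop :=
  exists chi : 'I_4 -> RR, (forall a, 0 <= chi a) /\
    forall rho, E rho = \sum_(a < 4) (chi a)%:C *: (pauli a *m rho *m pauli a).

Definition prob7 (p : 'I_7 -> RR) : Prop :=
  (forall j, 0 <= p j) /\ \sum_(j < 7) p j = 1.

Definition unit3 (v : 'I_3 -> RR) : Prop := \sum_(k < 3) v k ^+ 2 = 1.

Definition ehat (c eps : RR) (v : 'I_3 -> RR) (i : 'I_4) : RR :=
  match val i with
  | 0 => Num.sqrt (1 - (c * eps) ^+ 2)
  | k.+1 => c * eps * v (inord k)
  end.

Definition Erem (p : 'I_7 -> RR) (Us : 'I_7 -> 'M[C]_2) (Uhat : 'M[C]_2) : qmap :=
  qcomp (qmix p Us) (uchan (adj Uhat)).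

(* Main.v *)
(** A unitary [W] of size 2 is, up to a phase, [\sum_a r_a Q_a] for a real unit
    vector [r] of R^4 and the quaternion basis [Q = (1, iZ, iX, -iY)] (the
    magic basis in vectorized form), so [\sum_j p_j U_j Uhat^-1] is a Pauli
    channel as soon as the six off-diagonal entries of [\sum_j p_j r_j r_j^T]
    vanish.  Rescaled, these entries are small perturbations of [v_k] and
    [v_k v_l]; the seven rational directions [dir] are chosen so that the
    origin is interior to the simplex spanned by the unperturbed 6-vectors,
    and then it stays interior for large [c].

    Half the diamond distance of two unitary channels is the sine of the angle
    between their lines in R^4, and half the diamond distance of [Uhat] to a
    mixture with Pauli remnant is [1 - chi_II = \sum_j p_j (1 - r_j0^2)].  The
    triangle inequality for sines puts each [1 - r_j0^2] between
    [((c - 1) eps)^2] and [((c + 1) eps)^2]. *)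

Require Import Defs.
From HB Require Import structures.
From mathcomp Require Import all_boot all_order all_algebra.
From mathcomp Require Import complex.
From mathcomp Require Import classical_sets reals.
From mathcomp Require Import Rstruct.
From mathcomp Require Import ring lra.

Set Implicit Arguments.
Unset Strict Implicit.
Unset Printing Implicit Defensive.

Import Order.TTheory GRing.Theory Num.Theory.
Import ComplexField.
Local Open Scope complex_scope.
Local Open Scope ring_scope.

(** * Linear systems close to the identity *)

Lemma perturbed_identity_entry (R : realFieldType) (n : nat) (N : 'M[R]_n)
    (eta B : R) (x : 'cV[R]_n) (i : 'I_n) :
  (forall i j, `|(N - 1%:M) i j| <= eta) -> (forall j, `|x j 0| <= B) ->
  `|(N *m x) i 0 - x i 0| <= n%:R * eta * B.
Proof.
move=> hN hB.
have -> : (N *m x) i 0 - x i 0 = ((N - 1%:M) *m x) i 0.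
  by rewrite mulmxBl mul1mx !mxE.
rewrite mxE; apply: le_trans (ler_norm_sum _ _ _) _.
have -> : n%:R * eta * B = \sum_(j < n) eta * B.
  by rewrite sumr_const card_ord -[RHS]mulr_natl mulrA.
by apply: ler_sum => j _; rewrite normrM ler_pM.
Qed.

(** At an index where [|x i|] is maximal, [N x] and [x] differ by at most half of that maximum, so
    the maximum is at most [B] plus half of itself. *)
Lemma perturbed_identity_bound (R : realFieldType) (n : nat) (N : 'M[R]_n)
    (eta B : R) (x : 'cV[R]_n) :
  (forall i j, `|(N - 1%:M) i j| <= eta) -> n%:R * eta <= 2^-1 ->
  (forall i, `|(N *m x) i 0| <= B) -> forall i, `|x i 0| <= 2 * B.
Proof.
move=> hN heta hB i0.
have [i _ hi] := @arg_maxP _ R 'I_n i0 xpredT (fun i => `|x i 0|) isT.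
apply: le_trans (hi i0 isT) _ => /=.
have h := perturbed_identity_entry i hN (fun j => hi j isT).
have := ler_normB ((N *m x) i 0) ((N *m x) i 0 - x i 0).
rewrite opprB addrC subrK => h2.
have := hB i; have := normr_ge0 (x i 0); move: h h2 => /=; nra.
Qed.

(** The preceding bound with [B = 0] makes the kernel trivial, and with [B = 1] it bounds the
    solution by 2. Hence the solution stays within [n eta 2] of [p0], which is the margin assumed on
    [p0]. *)
Lemma perturbed_identity_solve (R : realFieldType) (n : nat) (N : 'M[R]_n)
    (eta : R) (p0 : 'cV[R]_n) :
  (forall i j, `|(N - 1%:M) i j| <= eta) -> n%:R * eta <= 2^-1 ->
  (forall i, n%:R * eta * 2 <= p0 i 0 <= 1) ->
  exists p : 'cV[R]_n, N *m p = p0 /\ forall i, 0 <= p i 0.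
Proof.
move=> hN heta hp0.
have uN : N \in unitmx.
  rewrite unitmxE unitfE -det_tr; apply/negP => /det0P [v v0 hv].
  case/eqP: v0; apply/rowP => j; rewrite mxE.
  have hx : N *m v^T = 0 by rewrite -[N]trmxK -trmx_mul hv trmx0.
  have := @perturbed_identity_bound R n N eta 0 v^T hN heta _ j.
  rewrite mxE mulr0 normr_le0 => h; apply/eqP/h => i.
  by rewrite hx mxE normr0.
exists (invmx N *m p0); split=> [|i]; first by rewrite mulKVmx.
set p := invmx N *m p0; have hp : N *m p = p0 by rewrite /p mulKVmx.
have hb j : `|p j 0| <= 2.
  rewrite -[2]mulr1; apply: (perturbed_identity_bound hN heta _ j) => k.
  rewrite hp; have /andP[h1 h2] := hp0 k; rewrite ger0_norm //.
  apply: le_trans h1; rewrite mulr_ge0 // mulr_ge0 //.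
  by apply: le_trans (hN k k).
have := perturbed_identity_entry i hN hb.
have /andP[h1 _] := hp0 i.
by rewrite hp => /(le_trans (ler_norm _)); lra.
Qed.

(** * Geometry of unit vectors of R^4 *)

Lemma sum4 (V : nmodType) (F : 'I_4 -> V) :
  \sum_(a < 4) F a = F (inord 0) + F (inord 1) + F (inord 2) + F (inord 3).
Proof.
rewrite !big_ord_recl big_ord0 addr0 !addrA.
by do 3?[congr (_ + _)]; congr (F _); apply/val_inj; rewrite /= inordK.
Qed.

Lemma sum3 (V : nmodType) (F : 'I_3 -> V) :
  \sum_(a < 3) F a = F (inord 0) + F (inord 1) + F (inord 2).
Proof.
rewrite !big_ord_recl big_ord0 addr0 !addrA.
by do 2?[congr (_ + _)]; congr (F _); apply/val_inj; rewrite /= inordK.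
Qed.

Lemma forall4 (P : 'I_4 -> Prop) :
  P (inord 0) -> P (inord 1) -> P (inord 2) -> P (inord 3) -> forall a, P a.
Proof.
move=> h0 h1 h2 h3 a; rewrite -[a]inord_val.
by case: a => [[|[|[|[|k]]]] hk].
Qed.

Lemma inord4K : ((val (inord 0 : 'I_4) = 0%N) * (val (inord 1 : 'I_4) = 1%N) *
  (val (inord 2 : 'I_4) = 2%N) * (val (inord 3 : 'I_4) = 3%N))%type.
Proof. by rewrite /= !inordK. Qed.

Lemma ehatE c eps v :
  ((ehat c eps v (inord 0) = Num.sqrt (1 - (c * eps) ^+ 2))%R *
   (ehat c eps v (inord 1) = c * eps * v (inord 0))%R *
   (ehat c eps v (inord 2) = c * eps * v (inord 1))%R *
   (ehat c eps v (inord 3) = c * eps * v (inord 2))%R)%type.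
Proof. by rewrite /ehat !inord4K. Qed.

Lemma ehat_unit (c eps : RR) v : unit3 v -> (c * eps) ^+ 2 <= 1 ->
  \sum_(a < 4) ehat c eps v a ^+ 2 = 1.
Proof.
rewrite /unit3 sum3 => hv hs; rewrite sum4 !ehatE sqr_sqrtr; last by lra.
by have := congr1 ( *%R ((c * eps) ^+ 2)) hv; lra.
Qed.

Lemma cauchy_schwarz4 (r e : 'I_4 -> RR) :
  (\sum_(a < 4) r a * e a) ^+ 2 <=
  (\sum_(a < 4) r a ^+ 2) * (\sum_(a < 4) e a ^+ 2).
Proof.
rewrite !sum4.
move: (r _) (r _) (r _) (r _) (e _) (e _) (e _) (e _) => d c b a t z y x.
rewrite -subr_ge0.
(* Lagrange's identity. *)
have -> : (a ^+ 2 + b ^+ 2 + c ^+ 2 + d ^+ 2) *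
  (x ^+ 2 + y ^+ 2 + z ^+ 2 + t ^+ 2) - (a * x + b * y + c * z + d * t) ^+ 2 =
  (a * y - b * x) ^+ 2 + (a * z - c * x) ^+ 2 + (a * t - d * x) ^+ 2 +
  (b * z - c * y) ^+ 2 + (b * t - d * y) ^+ 2 + (c * t - d * z) ^+ 2 by ring.
by rewrite !addr_ge0 ?sqr_ge0.
Qed.

(* The sine of the angle between lines of R^4 satisfies the triangle
   inequality, here for the lines spanned by [r], [e] and the first axis. *)
Lemma sine_triangle (r e : 'I_4 -> RR) :
  \sum_(a < 4) r a ^+ 2 = 1 -> \sum_(a < 4) e a ^+ 2 = 1 ->
  (Num.sqrt (1 - r (inord 0) ^+ 2) - Num.sqrt (1 - e (inord 0) ^+ 2)) ^+ 2 <=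
  1 - (\sum_(a < 4) r a * e a) ^+ 2.
Proof.
rewrite !sum4.
move: (r _) (r _) (r _) (r _) (e _) (e _) (e _) (e _) => d c b a t z y x.
move=> hr he.
have h0 : 0 <= 1 - a ^+ 2 by nra.
have h1 : 0 <= 1 - x ^+ 2 by nra.
have := sqrtr_ge0 (1 - a ^+ 2); have := sqrtr_ge0 (1 - x ^+ 2).
have := sqr_sqrtr h0; have := sqr_sqrtr h1.
move: (Num.sqrt _) (Num.sqrt _) => p s hs hp s0 p0.
set u := b * y + c * z + d * t.
have -> : a * x + b * y + c * z + d * t = a * x + u by rewrite /u; ring.
have hu : u ^+ 2 <= (p * s) ^+ 2.
  rewrite exprMn hs hp.
  have -> : 1 - a ^+ 2 = b ^+ 2 + c ^+ 2 + d ^+ 2 by lra.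
  have -> : 1 - x ^+ 2 = y ^+ 2 + z ^+ 2 + t ^+ 2 by lra.
  rewrite -subr_ge0.
  have -> : (b ^+ 2 + c ^+ 2 + d ^+ 2) * (y ^+ 2 + z ^+ 2 + t ^+ 2) - u ^+ 2 =
    (b * z - c * y) ^+ 2 + (b * t - d * y) ^+ 2 + (c * t - d * z) ^+ 2.
    by rewrite /u; ring.
  by rewrite !addr_ge0 ?sqr_ge0.
have ps0 : 0 <= p * s by rewrite mulr_ge0.
have hu' : `|u| <= p * s.
  by rewrite -[p * s]ger0_norm // -ler_sqr ?nnegrE // !real_normK ?num_real.
(* With [p] and [s] the two sines, the product of the cosines is at most [1 - p s]. Expanding
   [(a x + u)^2] with this and [|u| <= p s] leaves exactly [1 - (p - s)^2]. *)
have hax : `|a * x| <= 1 - p * s.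
  have : 2 * p * s <= p ^+ 2 + s ^+ 2 by have := sqr_ge0 (p - s); lra.
  have : 2 * `|a * x| <= a ^+ 2 + x ^+ 2.
    rewrite normrM -(real_normK (num_real a)) -(real_normK (num_real x)).
    by have := sqr_ge0 (`|a| - `|x|); lra.
  by lra.
have haxu : a * x * u <= (1 - p * s) * (p * s).
  by apply: le_trans (ler_norm _) _; rewrite normrM ler_pM.
have hax2 : (a * x) ^+ 2 = (1 - p ^+ 2) * (1 - s ^+ 2).
  by rewrite exprMn hp hs; ring.
have -> : (a * x + u) ^+ 2 = (a * x) ^+ 2 + 2 * (a * x * u) + u ^+ 2 by ring.
have -> : (p - s) ^+ 2 = p ^+ 2 + s ^+ 2 - 2 * (p * s) by ring.
rewrite hax2; move: hu; rewrite exprMn; lra.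
Qed.

Lemma sine_bounds (c eps : RR) v (r : 'I_4 -> RR) :
  unit3 v -> 1 <= c -> 0 <= eps -> c * eps <= 1 ->
  \sum_(a < 4) r a ^+ 2 = 1 ->
  1 - eps ^+ 2 <= (\sum_(a < 4) r a * ehat c eps v a) ^+ 2 ->
  ((c - 1) * eps) ^+ 2 <= 1 - r (inord 0) ^+ 2 <= ((c + 1) * eps) ^+ 2.
Proof.
move=> hv c1 e0 ce1 hr hx.
have hs0 : 0 <= c * eps by nra.
have he := ehat_unit hv (_ : (c * eps) ^+ 2 <= 1).
have hs2 : (c * eps) ^+ 2 <= 1 by nra.
have := sine_triangle hr (he hs2).
rewrite ehatE sqr_sqrtr; last by lra.
rewrite subKr sqrtr_sqr (ger0_norm hs0).
have h0 : 0 <= 1 - r (inord 0) ^+ 2 by move: hr; rewrite sum4; nra.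
rewrite -{2 3}(sqr_sqrtr h0); have := sqrtr_ge0 (1 - r (inord 0) ^+ 2).
move: (Num.sqrt _) => p p0 h.
have : `|c * eps - p| <= eps.
  rewrite -ler_sqr ?nnegrE // real_normK ?num_real //.
  by move: h hx; lra.
rewrite ler_norml => /andP[h1 h2].
by rewrite !ler_sqr ?nnegrE //; try nra; apply/andP; split; nra.
Qed.

(** * The seven directions *)

(** The squared distance of [r] and [e] is [2 - 2 x] with [x] their inner product. Since
    [0 <= x <= 1], it is at most [2 (1 - x^2) <= 2 eps^2]. The sign condition rules out [r] close to
    [-e]. *)
Lemma unit_entry_close (r e : 'I_4 -> RR) (eps : RR) :
  \sum_(a < 4) r a ^+ 2 = 1 -> \sum_(a < 4) e a ^+ 2 = 1 -> 0 <= eps ->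
  0 <= \sum_(a < 4) r a * e a -> 1 - eps ^+ 2 <= (\sum_(a < 4) r a * e a) ^+ 2 ->
  forall a, `|r a - e a| <= 2 * eps.
Proof.
move=> hr he eps0 x0 hx a.
have := cauchy_schwarz4 r e; rewrite hr he.
move: hx x0; set x := \sum_(a < 4) r a * e a => hx x0 hx1.
have hd : \sum_(b < 4) (r b - e b) ^+ 2 = 2 - 2 * x.
  transitivity (\sum_(b < 4) r b ^+ 2 + \sum_(b < 4) e b ^+ 2 - 2 * x).
    by rewrite /x !sum4; ring.
  by rewrite hr he; ring.
have ha : (r a - e a) ^+ 2 <= 2 - 2 * x.
  rewrite -hd (bigD1 a) //= lerDl.
  by apply: sumr_ge0 => b _; rewrite sqr_ge0.
have x1 : x <= 1 by nra.
rewrite -ler_sqr ?nnegrE ?mulr_ge0 // real_normK ?num_real //.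
by move: ha x1 hx hx1 x0 eps0; nra.
Qed.

Lemma product_close (R : realFieldType) (a b a' b' d1 d2 B : R) :
  `|a - a'| <= d1 -> `|b - b'| <= d2 -> `|b| <= B -> `|a'| <= 1 ->
  `|a * b - a' * b'| <= d1 * B + d2.
Proof.
move=> h1 h2 hb ha.
have -> : a * b - a' * b' = (a - a') * b + a' * (b - b') by ring.
apply: le_trans (ler_normD _ _) _; rewrite !normrM.
apply: lerD; first by rewrite ler_pM.
by rewrite -[d2]mul1r ler_pM.
Qed.

(** Since [1 + 4 + 4 = 9], these vectors divided by 3 are rational unit vectors, so every check on
    them is exact arithmetic. *)
Definition dirz : seq (seq int) :=
  [:: [:: 2; 1; 2]; [:: -1; 2; 2]; [:: 2; 1; -2]; [:: 2; -2; -1];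
      [:: -2; -1; -2]; [:: -2; 2; -1]; [:: -1; -2; 2]].

Definition dir (j : 'I_7) (k : 'I_3) : RR :=
  (nth 0 (nth [::] dirz j) k)%:~R / 3.

Lemma dir_unit j : unit3 (dir j).
Proof.
rewrite /unit3 !big_ord_recl big_ord0 /dir.
by case: j => [[|[|[|[|[|[|[|j]]]]]]] hj] //=; lra.
Qed.

Lemma unit3_le1 v k : unit3 v -> `|v k| <= 1.
Proof.
rewrite /unit3 (bigD1 k) //= => h.
have h2 : 0 <= \sum_(i < 3 | i != k) v i ^+ 2.
  by apply: sumr_ge0 => b _; rewrite sqr_ge0.
rewrite -ler_sqr ?nnegrE // real_normK ?num_real //; lra.
Qed.

(* Apart from the normalization in row 0, these are the off-diagonal entries
   of [r r^T], rescaled so that their limits as [s] tends to 0 are integers. *)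
Definition feature (s : RR) (r : 'I_4 -> RR) (i : 'I_7) : RR :=
  let q a b := r (inord a) * r (inord b) in
  nth 0 [:: 1; 3 * (q 0%N 1%N / s); 3 * (q 0%N 2%N / s); 3 * (q 0%N 3%N / s);
    9 * (q 1%N 2%N / s ^+ 2); 9 * (q 1%N 3%N / s ^+ 2); 9 * (q 2%N 3%N / s ^+ 2)] i.

Definition feature_lim (v : 'I_3 -> RR) (i : 'I_7) : RR :=
  let q a b := v (inord a) * v (inord b) in
  nth 0 [:: 1; 3 * v (inord 0); 3 * v (inord 1); 3 * v (inord 2);
    9 * q 0%N 1%N; 9 * q 0%N 2%N; 9 * q 1%N 2%N] i.

(** With [k = 1 / c], each [r_a / s] is within [2 k] of the matching entry of [v] and bounded by 3,
    while [r_0] is within [3 k] of 1. The worst case is a quadratic feature, with error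
    [9 (2 k 3 + 2 k) = 72 k]. *)
Lemma feature_close (c eps : RR) v (r : 'I_4 -> RR) i :
  unit3 v -> 1 <= c -> 0 < eps -> c ^+ 3 * eps <= 1 ->
  \sum_(a < 4) r a ^+ 2 = 1 ->
  1 - eps ^+ 2 <= (\sum_(a < 4) r a * ehat c eps v a) ^+ 2 ->
  `|feature (c * eps) r i - feature_lim v i| <= 72 / c.
Proof.
move=> hv c1 e0 ce1.
(* Features are constant or quadratic in [r], so [r] and [-r] have the same ones. *)
wlog x0 : r / 0 <= \sum_(a < 4) r a * ehat c eps v a.
  move=> H hr hx.
  have [x0|x0] := leP 0 (\sum_(a < 4) r a * ehat c eps v a); first exact: H.
  have hN : \sum_(a < 4) - r a * ehat c eps v a =
      - \sum_(a < 4) r a * ehat c eps v a.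
    by rewrite -sumrN; apply: eq_bigr => a _; rewrite mulNr.
  have := H (fun a => - r a); rewrite hN sqrrN /feature !mulrNN.
  apply=> //; first by rewrite oppr_ge0 ltW.
  by rewrite -[RHS]hr; apply: eq_bigr => a _; rewrite sqrrN.
move=> hr hx.
have c0 : 0 < c by lra.
set s := c * eps; set k := c^-1.
have k0 : 0 < k by rewrite invr_gt0.
have ek : eps = k * s by rewrite /k /s mulKf // gt_eqF.
have s0 : 0 < s by rewrite mulr_gt0.
have k1 : k <= 1 by rewrite invf_le1.
(* This is [c^3 eps <= 1] rewritten; it makes the normalization error [s^2] of the first coordinate
   at most [k]. *)
have sk : s <= k ^+ 2.
  rewrite /k exprVn -[X in _ <= X]mulr1 ler_pdivlMl ?exprn_gt0 //.
  by move: ce1; rewrite /s; lra.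
have s1 : s <= 1 by nra.
have ss1 : s ^+ 2 <= 1 by nra.
have he := ehat_unit hv ss1.
have hd := unit_entry_close hr he (ltW e0) x0 hx.
have hv1 := fun a => unit3_le1 a hv.
have hq : forall a b, `|r a / s - v b| <= 2 * k -> `|r a / s| <= 3.
  move=> a b h; rewrite -[r a / s](subrK (v b)).
  by apply: le_trans (ler_normD _ _) _; have := hv1 b; lra.
have hu : forall a b, `|r a - s * v b| <= 2 * eps -> `|r a / s - v b| <= 2 * k.
  move=> a b; have -> : r a - s * v b = (r a / s - v b) * s.
    by rewrite mulrBl divfK ?gt_eqF // [s * _]mulrC.
  rewrite normrM (gtr0_norm s0) => h; rewrite -(ler_pM2r s0).
  by apply: le_trans h _; rewrite -mulrA -ek.
have r01 : `|r (inord 0)| <= 1.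
  rewrite -ler_sqr ?nnegrE // real_normK ?num_real //.
  by move: hr; rewrite sum4; nra.
have e01 : `|ehat c eps v (inord 0) - 1| <= s ^+ 2.
  rewrite ehatE -/s.
  have := sqrtr_ge0 (1 - s ^+ 2).
  have := @sqr_sqrtr _ (1 - s ^+ 2); rewrite subr_ge0 => /(_ ss1).
  move: (Num.sqrt _) => q hq2 q0; have q1 : q <= 1 by nra.
  by rewrite ler_norml; apply/andP; split; nra.
have hr0 : `|r (inord 0) - 1| <= 3 * k.
  rewrite -[r _](subrK (ehat c eps v (inord 0))) -addrA.
  apply: le_trans (ler_normD _ _) _; have := hd (inord 0).
  have : eps <= k by rewrite ek; nra.
  have : s ^+ 2 <= k by nra.
  by move: e01; lra.
have h1 : `|r (inord 1) / s - v (inord 0)| <= 2 * k.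
  by apply: hu; have := hd (inord 1); rewrite ehatE.
have h2 : `|r (inord 2) / s - v (inord 1)| <= 2 * k.
  by apply: hu; have := hd (inord 2); rewrite ehatE.
have h3 : `|r (inord 3) / s - v (inord 2)| <= 2 * k.
  by apply: hu; have := hd (inord 3); rewrite ehatE.
have hlin : forall a b, `|r a / s - v b| <= 2 * k ->
    `|3 * (r (inord 0) * r a / s) - 3 * v b| <= 72 * k.
  move=> a b h; rewrite -mulrBr normrM ger0_norm // -mulrA -[v b]mul1r.
  have := product_close hr0 h (hq _ _ h) (_ : `|1 : RR| <= 1).
  by rewrite normr1 lexx => /(_ isT); lra.
have hquad : forall a b a' b', `|r a / s - v a'| <= 2 * k ->
    `|r b / s - v b'| <= 2 * k ->
    `|9 * (r a * r b / s ^+ 2) - 9 * (v a' * v b')| <= 72 * k.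
  move=> a b a' b' ha hb; rewrite -mulrBr normrM ger0_norm //.
  have -> : r a * r b / s ^+ 2 = (r a / s) * (r b / s).
    by rewrite expr2 invfM mulrACA.
  by have := product_close ha hb (hq _ _ hb) (hv1 a'); lra.
case: i => [[|[|[|[|[|[|[|i]]]]]]] hi] //=.
all: rewrite /feature /feature_lim /=.
- by rewrite subrr normr0; apply: mulr_ge0 => //; apply: ltW.
- exact: hlin.
- exact: hlin.
- exact: hlin.
- exact: hquad.
- exact: hquad.
- exact: hquad.
Qed.

Definition feature_mx : 'M[RR]_7 := \matrix_(i, j) feature_lim (dir j) i.

(** Numerators, over the common denominator 828, of the inverse of [feature_mx]. *)
Definition feature_invz : seq (seq int) :=
  [:: [:: 120; 118; 34; 72; 12; 73; -11];
      [:: 90; -84; 60; 54; 9; -66; 78];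
      [:: 126; 48; 84; -90; 54; -51; -15];
      [:: 108; 74; -112; -18; -72; -1; 20];
      [:: 126; -90; -54; -90; 54; 18; 54];
      [:: 108; -18; 72; -18; -72; 45; -72];
      [:: 150; -48; -84; 90; 15; -18; -54]].

Definition feature_inv : 'M[RR]_7 :=
  \matrix_(i, j) ((nth 0 (nth [::] feature_invz i) j)%:~R / 828).

Lemma feature_invK : feature_inv *m feature_mx = 1%:M.
Proof.
apply/matrixP => i j; rewrite !mxE !big_ord_recl big_ord0 !mxE.
rewrite /feature_lim /dir !inordK //.
case: i => [[|[|[|[|[|[|[|i]]]]]]] hi] //=;
case: j => [[|[|[|[|[|[|[|j]]]]]]] hj] //=; lra.
Qed.

Lemma feature_inv_le i j : `|feature_inv i j| <= 5^-1.
Proof.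
rewrite mxE ler_norml.
case: i => [[|[|[|[|[|[|[|i]]]]]]] hi] //=;
case: j => [[|[|[|[|[|[|[|j]]]]]]] hj] //=; apply/andP; split; lra.
Qed.

(** The first column of the inverse holds the barycentric coordinates of the origin in the simplex
    of the unperturbed 6-vectors. The lower bound is the room available for the perturbation. *)
Lemma feature_inv_weights i : 10^-1 <= feature_inv i ord0 <= 1.
Proof.
rewrite mxE.
case: i => [[|[|[|[|[|[|[|i]]]]]]] hi] //=; apply/andP; split; lra.
Qed.

(** Multiplying the perturbed feature matrix [M] by [feature_inv] gives a matrix close to the
    identity. Solving for the first column of [feature_inv] yields nonnegative [p] with [M p] the
    first unit vector: row 0 says that the weights sum to 1, the other rows that the off-diagonal
    entries vanish. *)
Lemma diagonalizing_weights (c eps : RR) (r : 'I_7 -> 'I_4 -> RR) :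
  10 ^+ 5 <= c -> 0 < eps -> c ^+ 3 * eps <= 1 ->
  (forall j, \sum_(a < 4) r j a ^+ 2 = 1) ->
  (forall j, 1 - eps ^+ 2 <= (\sum_(a < 4) r j a * ehat c eps (dir j) a) ^+ 2) ->
  exists2 p, prob7 p &
    forall a b, a != b -> \sum_(j < 7) p j * (r j a * r j b) = 0.
Proof.
move=> hc e0 ce hr hx.
have c1 : 1 <= c by lra.
have c0 : 0 < c by lra.
pose M : 'M[RR]_7 := \matrix_(i, j) feature (c * eps) (r j) i.
have hM i j : `|(M - feature_mx) i j| <= 1000^-1.
  rewrite !mxE; apply: le_trans (feature_close i (dir_unit j) c1 e0 ce (hr j) (hx j)) _.
  by rewrite ler_pdivrMr //; lra.
(* The error is at most [7 / (5 1000)]. With [eta = 1 / 700] and [n = 7], [n eta] is 1/100, below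
   1/2, and [n eta 2] is 1/50, below the margin 1/10. *)
have hN i j : `|(feature_inv *m M - 1%:M) i j| <= 700^-1.
  rewrite -feature_invK -mulmxBr mxE; apply: le_trans (ler_norm_sum _ _ _) _.
  apply: (@le_trans _ _ (\sum_(k < 7) 5^-1 * 1000^-1)).
    by apply: ler_sum => k _; rewrite normrM ler_pM // feature_inv_le.
  by rewrite sumr_const card_ord -mulr_natl; lra.
have [||p [hp p0]] := perturbed_identity_solve (p0 := col ord0 feature_inv) hN.
- by lra.
- by move=> i; rewrite mxE; have := feature_inv_weights i; lra.
have hMp : M *m p = delta_mx ord0 0.
  rewrite -[M]mul1mx -(mulmx1C feature_invK) -mulmxA -mulmxA [feature_inv *m _]mulmxA hp.
  by rewrite colE mulmxA (mulmx1C feature_invK) mul1mx.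
have hrow i : \sum_j feature (c * eps) (r j) i * p j 0 = (i == ord0)%:R.
  have := congr1 (fun A : 'cV_7 => A i 0) hMp; rewrite !mxE andbT => <-.
  by apply: eq_bigr => j _; rewrite mxE.
have s0 : c * eps != 0 by rewrite mulf_neq0 ?gt_eqF.
have hz (q : 'I_7 -> RR) (t : RR) (i : 'I_7) : t != 0 -> i != ord0 ->
    (forall j, feature (c * eps) (r j) i = t * q j) ->
    \sum_(j < 7) p j 0 * q j = 0.
  move=> t0 i0 hf; apply: (mulfI t0); rewrite mulr0 mulr_sumr.
  transitivity (\sum_j feature (c * eps) (r j) i * p j 0); last first.
    by rewrite hrow (negPf i0).
  by apply: eq_bigr => j _; rewrite hf; ring.
exists (fun j => p j 0).
  split=> //; transitivity (\sum_j feature (c * eps) (r j) ord0 * p j 0); last first.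
    by rewrite hrow eqxx.
  by apply: eq_bigr => j _; rewrite /feature mul1r.
have t1 : 3 / (c * eps) != 0 by rewrite mulf_neq0 ?invr_neq0 ?pnatr_eq0.
have t2 : 9 / (c * eps) ^+ 2 != 0 by rewrite mulf_neq0 ?invr_neq0 ?expf_neq0 ?pnatr_eq0.
have sym a b : \sum_(j < 7) p j 0 * (r j a * r j b) = 0 ->
    \sum_(j < 7) p j 0 * (r j b * r j a) = 0.
  by move=> h; rewrite -[RHS]h; apply: eq_bigr => j _; rewrite [r j b * _]mulrC.
have h01 : \sum_(j < 7) p j 0 * (r j (inord 0) * r j (inord 1)) = 0.
  by apply: (hz _ _ (inord 1) t1); rewrite -?val_eqE /= /feature inordK //= => j; ring.
have h02 : \sum_(j < 7) p j 0 * (r j (inord 0) * r j (inord 2)) = 0.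
  by apply: (hz _ _ (inord 2) t1); rewrite -?val_eqE /= /feature inordK //= => j; ring.
have h03 : \sum_(j < 7) p j 0 * (r j (inord 0) * r j (inord 3)) = 0.
  by apply: (hz _ _ (inord 3) t1); rewrite -?val_eqE /= /feature inordK //= => j; ring.
have h12 : \sum_(j < 7) p j 0 * (r j (inord 1) * r j (inord 2)) = 0.
  by apply: (hz _ _ (inord 4) t2); rewrite -?val_eqE /= /feature inordK //= => j; ring.
have h13 : \sum_(j < 7) p j 0 * (r j (inord 1) * r j (inord 3)) = 0.
  by apply: (hz _ _ (inord 5) t2); rewrite -?val_eqE /= /feature inordK //= => j; ring.
have h23 : \sum_(j < 7) p j 0 * (r j (inord 2) * r j (inord 3)) = 0.
  by apply: (hz _ _ (inord 6) t2); rewrite -?val_eqE /= /feature inordK //= => j; ring.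
by apply: forall4; apply: forall4 => ab;
  solve [by case/eqP: ab | done | by apply: sym].
Qed.

(** * The trace norm *)

Lemma cabsD x y : cabs (x + y) <= cabs x + cabs y.
Proof. exact: le_normcD. Qed.

Lemma cabsM x y : cabs (x * y) = cabs x * cabs y.
Proof. exact: Normc.normcM. Qed.

Lemma cabs_ge0 z : 0 <= cabs z.
Proof. by case: z => a b; apply: sqrtr_ge0. Qed.

Lemma sqr_cabs (z : C) : ((cabs z) ^+ 2)%:C = z * z^*%C.
Proof.
case: z => a b; rewrite /cabs sqr_sqrtr ?addr_ge0 ?sqr_ge0 //.
by apply/eqP; rewrite eq_complex /=; apply/andP; split; apply/eqP; ring.
Qed.

Lemma cabs_conj (z : C) : cabs z^*%C = cabs z.
Proof. by case: z => a b /=; rewrite sqrrN. Qed.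

Lemma cabs_real (a : RR) : cabs a%:C = `|a|.
Proof. by rewrite /cabs /= expr0n addr0 sqrtr_sqr. Qed.

Lemma cabs_sum (I : finType) (F : I -> C) :
  cabs (\sum_i F i) <= \sum_i cabs (F i).
Proof.
elim/big_ind2: _ => //; first by rewrite /cabs /= expr0n addr0 sqrtr0.
by move=> x a y b hx hy; apply: le_trans (cabsD _ _) (lerD hx hy).
Qed.

Lemma dagK n m (A : 'M[C]_(n, m)) : adj (adj A) = A.
Proof. by apply/matrixP => i j; rewrite !mxE conjcK. Qed.

Lemma dagM n m q (A : 'M[C]_(n, m)) (B : 'M[C]_(m, q)) :
  adj (A *m B) = adj B *m adj A.
Proof. by rewrite /adj map_mxM trmx_mul. Qed.

Lemma dagB n m (A B : 'M[C]_(n, m)) : adj (A - B) = adj A - adj B.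
Proof. by apply/matrixP => i j; rewrite !mxE rmorphB. Qed.

Lemma dagD n m (A B : 'M[C]_(n, m)) : adj (A + B) = adj A + adj B.
Proof. by apply/matrixP => i j; rewrite !mxE rmorphD. Qed.

Lemma dagZ n m a (A : 'M[C]_(n, m)) : adj (a *: A) = a^*%C *: adj A.
Proof. by apply/matrixP => i j; rewrite !mxE rmorphM. Qed.

Lemma dag1 n : adj (1%:M : 'M[C]_n) = 1%:M.
Proof.
apply/matrixP => i j; rewrite !mxE eq_sym.
by case: (i == j); rewrite ?conjc1 ?conjc0.
Qed.

Lemma unitary1 n : unitary (1%:M : 'M[C]_n).
Proof. by rewrite /unitary dag1 mulmx1. Qed.

Lemma unitary_adj n (A : 'M[C]_n) : unitary A -> unitary (adj A).
Proof. by rewrite /unitary dagK => /mulmx1C. Qed.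

Lemma unitaryM n (A B : 'M[C]_n) : unitary A -> unitary B -> unitary (A *m B).
Proof.
by rewrite /unitary dagM mulmxA => hA hB; rewrite -(mulmxA A) hB mulmx1.
Qed.

Definition sqnorm n (u : 'cV[C]_n) : RR := \sum_i cabs (u i 0) ^+ 2.

Lemma adj_mul_self n (u : 'cV[C]_n) : adj u *m u = (sqnorm u)%:C%:M.
Proof.
apply/matrixP => i j; rewrite !ord1 !mxE eqxx mulr1n rmorph_sum /=.
by apply: eq_bigr => k _; rewrite !mxE sqr_cabs mulrC.
Qed.

Lemma sqnorm_unitary n (V : 'M[C]_n) u : unitary V -> sqnorm (V *m u) = sqnorm u.
Proof.
move=> /mulmx1C hV.
have : adj (V *m u) *m (V *m u) = adj u *m u.
  by rewrite dagM -mulmxA [adj V *m _]mulmxA hV mul1mx.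
rewrite !adj_mul_self => /matrixP /(_ 0 0); rewrite !mxE eqxx !mulr1n.
exact: complexI.
Qed.

Lemma cabs_dot_le n (x y : 'cV[C]_n) :
  cabs ((adj x *m y) 0 0) <= 2^-1 * (sqnorm x + sqnorm y).
Proof.
rewrite mxE /sqnorm -big_split mulr_sumr.
apply: le_trans (cabs_sum _) _; apply: ler_sum => i _ /=.
rewrite !mxE cabsM cabs_conj.
by have := sqr_ge0 (cabs (x i 0) - cabs (y i 0)); lra.
Qed.

Lemma cabs_unitary_entry n (V : 'M[C]_n) i j : unitary V -> cabs (V i j) <= 1.
Proof.
move=> /unitary_adj /(sqnorm_unitary (delta_mx i 0)) hV.
have := cabs_ge0 (V i j).
have : cabs (V i j) ^+ 2 <= 1.
  have <- : sqnorm (delta_mx i 0 : 'cV[C]_n) = 1.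
    rewrite /sqnorm (bigD1 i) //= big1 ?mxE ?eqxx ?addr0.
      by rewrite (cabs_real 1) normr1 expr1n.
    move=> k /negPf hk; rewrite mxE hk (cabs_real 0) normr0 expr0n //.
  rewrite -hV /sqnorm (bigD1 j) //= -colE !mxE cabs_conj lerDl.
  by apply: sumr_ge0 => k _; rewrite sqr_ge0.
by rewrite -[1 in X in X -> _](expr1n _ 2) => h h0; rewrite -ler_sqr ?nnegrE.
Qed.

Section TraceNorm.
Variable n : nat.
Implicit Types A B V W : 'M[C]_n.

Let trset A : set RR :=
  [set x | exists V : 'M[C]_n, unitary V /\ x = cabs (\tr (V *m A))]%classic.

Lemma trnorm_ge V A : unitary V -> cabs (\tr (V *m A)) <= trnorm A.
Proof.
move=> hV; apply: (@ub_le_sup _ (trset A)); last by exists V.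
(* An element lies below [sup] only if the set is bounded; entries of a unitary have modulus at most
   1, so the sum of the moduli of the entries of [A] is a bound. *)
exists (\sum_i \sum_j cabs (A j i)) => _ [W [hW ->]].
apply: le_trans (cabs_sum _) _; apply: ler_sum => i _; rewrite mxE.
apply: le_trans (cabs_sum _) _; apply: ler_sum => j _; rewrite cabsM.
by rewrite -[X in _ <= X]mul1r ler_wpM2r ?cabs_ge0 ?cabs_unitary_entry.
Qed.

Lemma trnorm_le A (B : RR) :
  (forall V, unitary V -> cabs (\tr (V *m A)) <= B) -> trnorm A <= B.
Proof.
move=> h; apply: (@ge_sup _ (trset A)).
  by exists (cabs (\tr (1%:M *m A))), 1%:M; split=> //; apply: unitary1.
by move=> _ [V [hV ->]]; apply: h.
Qed.

Lemma trnorm_ge0 A : 0 <= trnorm A.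
Proof. exact: le_trans (cabs_ge0 _) (trnorm_ge A (unitary1 n)). Qed.

Lemma trnormD A B : trnorm (A + B) <= trnorm A + trnorm B.
Proof.
apply: trnorm_le => V hV; rewrite mulmxDr mxtraceD.
by apply: le_trans (cabsD _ _) (lerD _ _); apply: trnorm_ge.
Qed.

Lemma trnormZ (a : C) A : trnorm (a *: A) <= cabs a * trnorm A.
Proof.
apply: trnorm_le => V hV; rewrite -scalemxAr mxtraceZ cabsM.
by apply: ler_wpM2l; [apply: cabs_ge0 | apply: trnorm_ge].
Qed.

Lemma trnorm_sum (I : finType) (P : pred I) (F : I -> 'M[C]_n) :
  trnorm (\sum_(i | P i) F i) <= \sum_(i | P i) trnorm (F i).
Proof.
elim/big_ind2: _ => //.
  by apply: trnorm_le => V _; rewrite mulmx0 mxtrace0 (cabs_real 0) normr0.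
by move=> X a Y b hX hY; apply: le_trans (trnormD _ _) (lerD hX hY).
Qed.

Lemma trnorm_conj W A : unitary W -> trnorm (W *m A *m adj W) <= trnorm A.
Proof.
move=> hW; apply: trnorm_le => V hV.
have -> : \tr (V *m (W *m A *m adj W)) = \tr ((adj W *m V *m W) *m A).
  by rewrite mulmxA mxtrace_mulC !mulmxA.
by apply: trnorm_ge; do !apply: unitaryM => //; apply: unitary_adj.
Qed.

(** The pairing with [V] is the inner product of [u] and [V u], two vectors of the same norm. *)
Lemma trnorm_rank1 (u : 'cV[C]_n) : trnorm (u *m adj u) <= sqnorm u.
Proof.
apply: trnorm_le => V hV; rewrite mulmxA mxtrace_mulC.
rewrite /mxtrace big_ord1.
apply: le_trans (cabs_dot_le _ _) _; rewrite sqnorm_unitary //; lra.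
Qed.

End TraceNorm.

Lemma outer_mul n (u v w z : 'cV[C]_n) :
  (u *m adj v) *m (w *m adj z) = (adj v *m w) 0 0 *: (u *m adj z).
Proof.
rewrite mulmxA -(mulmxA u) [adj v *m w]mx11_scalar mul_mx_scalar.
by rewrite -scalemxAl !mxE eqxx mulr1n.
Qed.

Lemma tr_outer n (u v : 'cV[C]_n) : \tr (u *m adj v) = (adj v *m u) 0 0.
Proof. by rewrite mxtrace_mulC /mxtrace big_ord1. Qed.

Lemma adj_outer n (u v : 'cV[C]_n) : adj (u *m adj v) = v *m adj u.
Proof. by rewrite dagM dagK. Qed.

Lemma dotC n (u v : 'cV[C]_n) : (adj v *m u) 0 0 = ((adj u *m v) 0 0)^*%C.
Proof. by rewrite -{1}[u]dagK -dagM [adj (_ *m _)]/adj 2!mxE. Qed.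

Lemma dot_self n (u : 'cV[C]_n) : (adj u *m u) 0 0 = (sqnorm u)%:C.
Proof. by rewrite adj_mul_self mxE eqxx mulr1n. Qed.

(* With [M = u u^+ - w w^+] and [s^2 = 1 - |<u,w>|^2] one has [M^3 = s^2 M],
   so [M / s + (1 - M^2 / s^2)] is a unitary whose pairing with [M] is [2 s]. *)
Lemma trnorm_rank1_sub n (u w : 'cV[C]_n) :
  sqnorm u = 1 -> sqnorm w = 1 ->
  2 * Num.sqrt (1 - cabs ((adj u *m w) 0 0) ^+ 2) <=
  trnorm (u *m adj u - w *m adj w).
Proof.
move=> hu hw; set f := (adj u *m w) 0 0.
set t := 1 - cabs f ^+ 2; set s := Num.sqrt t.
(* When [t <= 0], the square root is 0 and nonnegativity of the trace norm suffices; otherwise [s]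
   can be inverted. *)
have [t0|t0] := ltP 0 t; last first.
  by rewrite /s ler0_sqrtr // mulr0 trnorm_ge0.
have s0 : s != 0 by rewrite gt_eqF // sqrtr_gt0.
have st : s * s = t by rewrite -expr2 sqr_sqrtr // ltW.
set P := u *m adj u; set Q := w *m adj w.
have PP : P *m P = P by rewrite outer_mul dot_self hu scale1r.
have QQ : Q *m Q = Q by rewrite outer_mul dot_self hw scale1r.
have hf : f * f^*%C = 1 - t%:C by rewrite -sqr_cabs /t rmorphB subKr.
have PQP : P *m Q *m P = (1 - t%:C) *: P.
  by rewrite !outer_mul -scalemxAl outer_mul scalerA [(adj w *m u) 0 0]dotC -hf.
have QPQ : Q *m P *m Q = (1 - t%:C) *: Q.
  by rewrite !outer_mul -scalemxAl outer_mul scalerA [(adj w *m u) 0 0]dotC -hf mulrC.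
have PH : adj P = P by rewrite adj_outer.
have QH : adj Q = Q by rewrite adj_outer.
have trP : \tr P = 1 by rewrite tr_outer dot_self hu.
have trQ : \tr Q = 1 by rewrite tr_outer dot_self hw.
have trPQ : \tr (P *m Q) = 1 - t%:C.
  by rewrite outer_mul mxtraceZ tr_outer [(adj w *m u) 0 0]dotC.
clearbody P Q.
pose M := P - Q; pose N := M *m M.
have MH : adj M = M by rewrite /M dagB PH QH.
rewrite -/M.
have MN : M *m N = t%:C *: M.
  rewrite /N /M !(mulmxBl, mulmxBr) PP QQ !mulmxA PP QQ PQP QPQ.
  move: (P *m Q) (Q *m P) => X Y.
  by apply/matrixP => i j; rewrite !mxE; ring.
have NM : N *m M = t%:C *: M by rewrite -mulmxA.
have NN : N *m N = t%:C *: N by rewrite {1}/N -mulmxA MN -scalemxAr.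
have trN : \tr N = (2 * t)%:C.
  rewrite /N /M !(mulmxBl, mulmxBr) PP QQ !raddfB /= [\tr (Q *m P)]mxtrace_mulC.
  by rewrite trP trQ trPQ rmorphM /= rmorph_nat; ring.
have MM : M *m M = N by [].
have NH : adj N = N by rewrite dagM MH.
clearbody N M.
pose a : C := (s^-1)%:C; pose b : C := (t^-1)%:C.
have aJ : a^*%C = a by exact: conjc_real.
have bJ : b^*%C = b by exact: conjc_real.
have ab : a * a = b by rewrite /a /b -st invfM rmorphM.
have bt : b * t%:C = 1 by rewrite /b -rmorphM /= mulVf ?rmorph1 ?gt_eqF.
have hat : a * (2 * t)%:C = (2 * s)%:C.
  by rewrite /a -rmorphM /= -st mulrCA mulKf.
clearbody a b.
pose V : 'M[C]_n := a *: M + (1%:M - b *: N).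
have VH : adj V = V.
  by rewrite /V dagD dagZ MH dagB dagZ dag1 NH aJ bJ.
have hV : unitary V.
  rewrite /unitary VH /V !(mulmxDl, mulmxDr, mulNmx, mulmxN) opprK.
  rewrite -!scalemxAl -!scalemxAr !mulmx1 !mul1mx MM MN NM NN -ab.
  move: bt; rewrite -ab => bt; apply/matrixP => i j; rewrite !mxE.
  move: (M i j) (N i j) (i == j)%:R t%:C bt => m k d tt bt.
  transitivity (d + k * (a * a) * (a * a * tt - 1) - 2 * a * m * (a * a * tt - 1)).
    by ring.
  by rewrite bt; ring.
have := trnorm_ge M hV; apply: le_trans.
rewrite /V mulmxDl mulmxBl -!scalemxAl mul1mx NM MM scalerA bt.
by rewrite scale1r subrr addr0 mxtraceZ trN hat cabs_real ler_norm.
Qed.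

(** The test unitary is the reflection [2 u u^+ - 1]: as [A] has trace 0, its pairing with [A] is
    twice the expectation of [A] in [u]. *)
Lemma trnorm_rank1_reflect n (u : 'cV[C]_n) (A : 'M[C]_n) (x : RR) :
  sqnorm u = 1 -> \tr A = 0 -> (adj u *m A *m u) 0 0 = x%:C ->
  2 * x <= trnorm A.
Proof.
move=> hu hA hx; pose P := u *m adj u.
have PP : P *m P = P by rewrite outer_mul dot_self hu scale1r.
have PH : adj P = P by rewrite adj_outer.
have trPA : \tr (P *m A) = x%:C.
  by rewrite /P -mulmxA mxtrace_mulC /mxtrace big_ord1 hx.
clearbody P.
have hV : unitary (P + P - 1%:M).
  rewrite /unitary dagB dagD dag1 PH !(mulmxDl, mulmxDr, mulNmx, mulmxN) opprK.
  rewrite !mulmx1 !mul1mx PP.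
  by apply/matrixP => i j; rewrite !mxE; ring.
apply: le_trans (trnorm_ge A hV); rewrite mulmxBl mulmxDl mul1mx raddfB raddfD /=.
have hxx : x%:C + x%:C = (x + x)%:C by rewrite rmorphD.
rewrite hA subr0 trPA hxx cabs_real.
by apply: le_trans (ler_norm _); lra.
Qed.

(** * Channels on half of a two-qubit system *)

Lemma sum2 (V : nmodType) (F : 'I_2 -> V) :
  \sum_(a < 2) F a = F (inord 0) + F (inord 1).
Proof.
rewrite !big_ord_recl big_ord0 addr0.
by congr (_ + _); congr (F _); apply/val_inj; rewrite /= inordK.
Qed.

Lemma forall2 (P : 'I_2 -> Prop) : P (inord 0) -> P (inord 1) -> forall a, P a.
Proof.
by move=> h0 h1 a; rewrite -[a]inord_val; case: a => [[|[|k]] hk].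
Qed.

Lemma val_tidx a b : val (tidx a b) = (2 * a + b)%N.
Proof. by rewrite /tidx /= inordK //; case: a => [[|[|?]] ?]; case: b => [[|[|?]] ?]. Qed.

Lemma hi_tidx a b : hi (tidx a b) = a.
Proof.
apply/val_inj; rewrite /hi /= [nat_of_ord (tidx a b)]val_tidx.
by rewrite inordK; case: a => [[|[|?]] ?]; case: b => [[|[|?]] ?].
Qed.

Lemma lo_tidx a b : lo (tidx a b) = b.
Proof.
apply/val_inj; rewrite /lo /= [nat_of_ord (tidx a b)]val_tidx.
by rewrite inordK; case: a => [[|[|?]] ?]; case: b => [[|[|?]] ?].
Qed.

Lemma tidx_inord (a b : nat) : (a < 2)%N -> (b < 2)%N ->
  tidx (inord a) (inord b) = inord (2 * a + b).
Proof. by move=> ha hb; rewrite /tidx !inordK. Qed.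

Lemma tidx_hilo i : tidx (hi i) (lo i) = i.
Proof.
by elim/forall4: i; rewrite -[inord _ in LHS]/(inord _);
  apply/val_inj; rewrite val_tidx /hi /lo /= !inordK.
Qed.

Lemma sum_tidx (V : nmodType) (F : 'I_4 -> V) :
  \sum_(i < 4) F i = \sum_(a < 2) \sum_(b < 2) F (tidx a b).
Proof. by rewrite sum4 !sum2 !tidx_inord // !addrA. Qed.

(** The Kronecker product of the identity with [U]. *)
Definition lift2 (U : 'M[C]_2) : 'M[C]_4 :=
  \matrix_(i, j) ((hi i == hi j)%:R * U (lo i) (lo j)).

Lemma sum_lift2 U i (F : 'I_4 -> C) :
  \sum_k lift2 U i k * F k = \sum_b U (lo i) b * F (tidx (hi i) b).
Proof.
rewrite sum_tidx (bigD1 (hi i)) //= [X in _ + X]big1 ?addr0.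
  by apply: eq_bigr => b _; rewrite mxE hi_tidx lo_tidx eqxx mul1r.
move=> a /negPf ha; apply: big1 => b _.
by rewrite mxE hi_tidx eq_sym ha !mul0r.
Qed.

Lemma sum_lift2r U j (F : 'I_4 -> C) :
  \sum_k F k * lift2 U k j = \sum_b F (tidx (hi j) b) * U b (lo j).
Proof.
rewrite sum_tidx (bigD1 (hi j)) //= [X in _ + X]big1 ?addr0.
  by apply: eq_bigr => b _; rewrite mxE hi_tidx lo_tidx eqxx mul1r.
move=> a /negPf ha; apply: big1 => b _.
by rewrite mxE hi_tidx ha mul0r mulr0.
Qed.

Lemma lift2M U V : lift2 U *m lift2 V = lift2 (U *m V).
Proof.
apply/matrixP => i j; rewrite mxE sum_lift2 !mxE mulr_sumr.
by apply: eq_bigr => b _; rewrite mxE hi_tidx lo_tidx; ring.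
Qed.

Lemma adj_lift2 U : adj (lift2 U) = lift2 (adj U).
Proof.
apply/matrixP => i j; rewrite !mxE eq_sym.
by rewrite rmorphM /= conjc_nat.
Qed.

Lemma lift2_1 : lift2 1%:M = 1%:M.
Proof.
apply/matrixP => i j; rewrite !mxE -natrM mulnb; congr (nat_of_bool _)%:R.
apply/andP/eqP => [[/eqP h1 /eqP h2]|->]; last by rewrite !eqxx.
by rewrite -(tidx_hilo i) -(tidx_hilo j) h1 h2.
Qed.

Lemma unitary_lift2 U : unitary U -> unitary (lift2 U).
Proof. by rewrite /unitary adj_lift2 lift2M => ->; apply: lift2_1. Qed.

Lemma idtensor_uchan U X :
  idtensor (uchan U) X = lift2 U *m X *m adj (lift2 U).
Proof.
apply/matrixP => i j; rewrite -mulmxA [RHS]mxE sum_lift2 mxE /uchan -mulmxA mxE.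
apply: eq_bigr => b _; congr (_ * _).
rewrite adj_lift2 mxE [RHS]mxE sum_lift2r.
by apply: eq_bigr => c _; rewrite mxE.
Qed.

Lemma idtensor_sub F G X :
  idtensor (qsub F G) X = idtensor F X - idtensor G X.
Proof. by apply/matrixP => i j; rewrite !mxE. Qed.

Lemma idtensor_wsum (I : finType) (w : I -> RR) (Fs : I -> qmap) F X :
  (forall rho, F rho = \sum_i (w i)%:C *: Fs i rho) ->
  idtensor F X = \sum_i (w i)%:C *: idtensor (Fs i) X.
Proof.
move=> h; apply/matrixP => i k; rewrite summxE mxE h summxE.
by apply: eq_bigr => j _; rewrite !mxE.
Qed.

Lemma idtensor_mix p Us X :
  idtensor (qmix p Us) X = \sum_(j < 7) (p j)%:C *: idtensor (uchan (Us j)) X.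
Proof. exact: (idtensor_wsum (Fs := fun j => uchan (Us j))). Qed.

Lemma trnorm_uchan U X : unitary U -> trnorm (idtensor (uchan U) X) <= trnorm X.
Proof. by move=> hU; rewrite idtensor_uchan; apply/trnorm_conj/unitary_lift2. Qed.

Lemma trnorm_wsum (I : finType) (P : pred I) (w : I -> RR) (F : I -> qmap) X :
  (forall i, 0 <= w i) ->
  (forall i, trnorm (idtensor (F i) X) <= trnorm X) ->
  trnorm (\sum_(i | P i) (w i)%:C *: idtensor (F i) X) <=
  (\sum_(i | P i) w i) * trnorm X.
Proof.
move=> hw hF; apply: le_trans (trnorm_sum _ _) _; rewrite mulr_suml.
apply: ler_sum => i _; apply: le_trans (trnormZ _ _) _.
by rewrite cabs_real ger0_norm ?ler_wpM2l.
Qed.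

Lemma trnormB n (A B : 'M[C]_n) : trnorm (A - B) <= trnorm A + trnorm B.
Proof.
apply: le_trans (trnormD _ _) _; rewrite lerD2l -scaleN1r.
apply: le_trans (trnormZ _ _) _.
have -> : (-1 : C) = (-1)%:C by rewrite rmorphN1.
rewrite cabs_real normrN1.
by rewrite mul1r.
Qed.

(** * The diamond norm as a supremum *)

Section DiamondNorm.
Variables (Phi : qmap) (B : RR).
Hypothesis hB : forall X, trnorm (idtensor Phi X) <= B * trnorm X.
Hypothesis B0 : 0 <= B.

Let dset : set RR :=
  [set x | exists X : 'M[C]_4, trnorm X <= 1 /\ x = trnorm (idtensor Phi X)]%classic.

Let dset_ub : ubound dset B.
Proof.
move=> _ [X [hX ->]]; apply: le_trans (hB X) _.
by rewrite -[X in _ <= X]mulr1 ler_wpM2l.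
Qed.

Lemma dnorm_le : dnorm Phi <= B.
Proof.
apply: (@ge_sup _ dset) => //.
exists (trnorm (idtensor Phi 0)), 0; split=> //.
apply: trnorm_le => V _; rewrite mulmx0 mxtrace0.
by rewrite (cabs_real 0) normr0.
Qed.

Lemma dnorm_ge X : trnorm X <= 1 -> trnorm (idtensor Phi X) <= dnorm Phi.
Proof.
move=> hX; apply: (@ub_le_sup _ dset); last by exists X.
by exists B; apply: dset_ub.
Qed.

End DiamondNorm.

(** * Lower bounds on the diamond norm *)

(** The normalized maximally entangled vector, the test state behind the lower bounds on the diamond
    norm. *)
Definition omega : 'cV[C]_4 := magic ord0.

Definition dot (u v : 'cV[C]_4) : C := (adj u *m v) 0 0.

Lemma conjcM (x y : C) : (x * y)^*%C = x^*%C * y^*%C.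
Proof. exact: rmorphM. Qed.

Lemma dot_outer (x y u : 'cV[C]_4) :
  (adj x *m (u *m adj u) *m y) 0 0 = dot x u * (dot y u)^*%C.
Proof.
rewrite !mulmxA -(mulmxA (adj x *m u)) [adj x *m u]mx11_scalar.
by rewrite mul_scalar_mx mxE (dotC y).
Qed.

Lemma isq2_conj : isq2^*%C = isq2.
Proof. exact: conjc_real. Qed.

Lemma isq2_sqr : isq2 * isq2 = 2^-1.
Proof.
rewrite /isq2 -rmorphM /= -invfM -expr2 sqr_sqrtr ?ler0n //.
by rewrite fmorphV rmorph_nat.
Qed.

Lemma omegaE a b : omega (tidx a b) 0 = isq2 * (a == b)%:R.
Proof.
rewrite mxE mxE; congr (_ * _); move: b; elim/forall2: a; elim/forall2;
  by rewrite tidx_inord // -val_eqE /= !inordK.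
Qed.

Lemma lift2_omega U a b : (lift2 U *m omega) (tidx a b) 0 = isq2 * U b a.
Proof.
rewrite mxE sum_lift2 hi_tidx lo_tidx (bigD1 a) //= big1 ?addr0.
  by rewrite omegaE eqxx mulr1 mulrC.
by move=> c /negPf ca; rewrite omegaE eq_sym ca mulr0 mulr0.
Qed.

(** Applying [lift2 U] to [omega] vectorizes [U] up to the factor [isq2], so the inner product
    becomes a normalized Hilbert-Schmidt product. *)
Lemma dot_lift2_omega U V :
  dot (lift2 U *m omega) (lift2 V *m omega) = 2^-1 * \tr (adj U *m V).
Proof.
rewrite /dot mxE sum_tidx /mxtrace mulr_sumr; apply: eq_bigr => a _.
rewrite mxE mulr_sumr; apply: eq_bigr => b _.
rewrite [adj _ _ _]mxE [map_mx _ _ _ _]mxE !lift2_omega conjcM isq2_conj.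
by rewrite !mxE -isq2_sqr; ring.
Qed.

Lemma sqnorm_lift2_omega U : unitary U -> sqnorm (lift2 U *m omega) = 1.
Proof.
move=> /mulmx1C hU; apply: complexI; rewrite -dot_self.
rewrite -[LHS]/(dot _ _) dot_lift2_omega hU mxtrace1 mulVf ?pnatr_eq0 //.
Qed.

Lemma sqnorm_omega : sqnorm omega = 1.
Proof. by rewrite -(sqnorm_lift2_omega (unitary1 2)) lift2_1 mul1mx. Qed.

Lemma idtensor_uchan_omega U :
  idtensor (uchan U) (omega *m adj omega) =
  (lift2 U *m omega) *m adj (lift2 U *m omega).
Proof. by rewrite idtensor_uchan dagM !mulmxA. Qed.

(** The entanglement fidelity of the two unitary channels; for unitaries, the squared cosine of the
    angle between the lines of their vectorizations. *)
Definition overlap (U V : 'M[C]_2) : RR := cabs (2^-1 * \tr (adj U *m V)) ^+ 2.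

Lemma sqr_overlap U V :
  (overlap U V)%:C = (2^-1 * \tr (adj U *m V)) * (2^-1 * \tr (adj U *m V))^*%C.
Proof. exact: sqr_cabs. Qed.

Lemma trnorm_omega : trnorm (omega *m adj omega) <= 1.
Proof. by rewrite -sqnorm_omega; apply: trnorm_rank1. Qed.

(** On the test state the difference of the channels is a difference of two rank-one projectors,
    which [trnorm_rank1_sub] handles. The crude bound 2 only ensures that the supremum is finite. *)
Lemma dnorm_uchan_ge U V : unitary U -> unitary V ->
  2 * Num.sqrt (1 - overlap U V) <= dnorm (qsub (uchan U) (uchan V)).
Proof.
move=> hU hV.
have hB X : trnorm (idtensor (qsub (uchan U) (uchan V)) X) <= 2 * trnorm X.
  rewrite idtensor_sub; apply: le_trans (trnormB _ _) _.
  rewrite mulr_natl mulr2n.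
  by apply: lerD; apply: trnorm_uchan.
apply: le_trans (dnorm_ge hB _ trnorm_omega) => //.
rewrite idtensor_sub !idtensor_uchan_omega /overlap -dot_lift2_omega.
by apply: trnorm_rank1_sub; apply: sqnorm_lift2_omega.
Qed.

(** On the test state the difference has trace 0, so the reflection in the vectorization of [U] can
    be used; the expectation of the difference there is 1 minus the average overlap. *)
Lemma dnorm_mix_ge U p Us : unitary U -> (forall j, unitary (Us j)) -> prob7 p ->
  2 * (1 - \sum_(j < 7) p j * overlap U (Us j)) <=
  dnorm (qsub (uchan U) (qmix p Us)).
Proof.
move=> hU hUs [p0 p1].
have hB X : trnorm (idtensor (qsub (uchan U) (qmix p Us)) X) <= 2 * trnorm X.
  rewrite idtensor_sub idtensor_mix; apply: le_trans (trnormB _ _) _.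
  have := trnorm_wsum (fun _ => true) p0 (fun j => trnorm_uchan X (hUs j)).
  by rewrite p1 mul1r mulr_natl mulr2n => h; apply: lerD => //; apply: trnorm_uchan.
apply: le_trans (dnorm_ge hB _ trnorm_omega) => //.
pose u V := lift2 V *m omega.
have -> : idtensor (qsub (uchan U) (qmix p Us)) (omega *m adj omega) =
    u U *m adj (u U) - \sum_(j < 7) (p j)%:C *: (u (Us j) *m adj (u (Us j))).
  rewrite idtensor_sub idtensor_mix (idtensor_uchan_omega U); congr (_ - _).
  by apply: eq_bigr => j _; rewrite (idtensor_uchan_omega (Us j)).
have u1 V : unitary V -> sqnorm (u V) = 1 by exact: sqnorm_lift2_omega.
have uu V W : dot (u V) (u W) = 2^-1 * \tr (adj V *m W).
  exact: dot_lift2_omega.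
clearbody u.
apply: (@trnorm_rank1_reflect _ (u U)); first exact: u1.
  have h : \tr (\sum_(j < 7) (p j)%:C *: (u (Us j) *m adj (u (Us j)))) =
      \tr (u U *m adj (u U)).
    rewrite tr_outer dot_self u1 // -p1 rmorph_sum raddf_sum.
    by apply: eq_bigr => j _; rewrite /= mxtraceZ tr_outer dot_self u1 // mulr1.
  by rewrite raddfB /= h subrr.
have hs : (adj (u U) *m (\sum_(j < 7) (p j)%:C *: (u (Us j) *m adj (u (Us j)))) *m u U) 0 0
    = \sum_(j < 7) (p j * overlap U (Us j))%:C.
  rewrite mulmx_sumr mulmx_suml summxE; apply: eq_bigr => j _.
  by rewrite -scalemxAr -scalemxAl mxE dot_outer uu -sqr_overlap -rmorphM.
rewrite mulmxBr mulmxBl mxE [in X in _ + X]mxE hs dot_outer /dot dot_self u1 //.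
by rewrite -rmorph_sum rmorphB conjc1 mulr1.
Qed.

(** * Quaternion coordinates of a unitary *)

(* [magic k] is the vectorization of [quat k / sqrt 2]. *)
Definition quat (k : 'I_4) : 'M[C]_2 :=
  match val k with
  | 0 => 1%:M
  | 1 => 'i%C *: pauli (inord 3)
  | 2 => 'i%C *: pauli (inord 1)
  | _ => - 'i%C *: pauli (inord 2)
  end.

(** Coordinates of [W] in [quat], orthonormal for half the trace form; equally the magic-basis
    coordinates of the vectorization of [W], see [dot_magic]. *)
Definition mcoef (W : 'M[C]_2) (a : 'I_4) : C := 2^-1 * \tr (adj (quat a) *m W).

Lemma magicE k a b : magic k (tidx a b) 0 = isq2 * quat k b a.
Proof.
rewrite /magic /quat.
elim/forall4: k; rewrite inord4K; elim/forall2: a; elim/forall2: b;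
  rewrite tidx_inord // !mxE /pauli ?inord4K ?mxE -?val_eqE /= !inordK //=;
  rewrite -?mulrA; congr (_ * _); rewrite ?mulr0 ?mulr1 //;
  apply/eqP; rewrite eq_complex /=; apply/andP; split; apply/eqP; ring.
Qed.

Lemma magic_quat k : magic k = lift2 (quat k) *m omega.
Proof.
apply/colP => i; rewrite -(tidx_hilo i) lift2_omega.
exact: magicE.
Qed.

Lemma quatE k : (quat k = match val k with
  | 0 => 1%:M
  | 1 => \matrix_(i < 2, j < 2) nth 0 (nth [::] [:: [:: 'i%C; 0]; [:: 0; - 'i%C]] i) j
  | 2 => \matrix_(i < 2, j < 2) nth 0 (nth [::] [:: [:: 0; 'i%C]; [:: 'i%C; 0]] i) j
  | _ => \matrix_(i < 2, j < 2) nth 0 (nth [::] [:: [:: 0; -1]; [:: 1; 0]] i) j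
  end)%R.
Proof.
rewrite /quat; elim/forall4: k; rewrite inord4K //; apply/matrixP => i j;
  rewrite /pauli inord4K !mxE;
  elim/forall2: i; elim/forall2: j; rewrite !inordK //=;
  apply/eqP; rewrite eq_complex /=; apply/andP; split; apply/eqP; ring.
Qed.

Lemma mcoefE W :
  ((mcoef W (inord 0) =
     2^-1 * (W (inord 0) (inord 0) + W (inord 1) (inord 1)))%R *
   (mcoef W (inord 1) =
     2^-1 * ('i%C * (W (inord 1) (inord 1) - W (inord 0) (inord 0))))%R *
   (mcoef W (inord 2) =
     2^-1 * (- 'i%C * (W (inord 1) (inord 0) + W (inord 0) (inord 1))))%R *
   (mcoef W (inord 3) =
     2^-1 * (W (inord 1) (inord 0) - W (inord 0) (inord 1)))%R)%type.
Proof.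
have iJ : 'i%C^*%C = - 'i%C :> C by apply/eqP; rewrite eq_complex /= oppr0 !eqxx.
rewrite /mcoef /mxtrace !sum2 !mxE !sum2 !quatE !inord4K !mxE.
rewrite -?val_eqE /= !inordK //=; rewrite ?conjc0 ?conjc1.
move: (W (inord 0) (inord 0)) (W (inord 0) (inord 1)) => [p p'] [q q'].
move: (W (inord 1) (inord 0)) (W (inord 1) (inord 1)) => [s s'] [t t'].
by split; [split; [split|]|]; congr (_ * _); apply/eqP;
  rewrite eq_complex /=; apply/andP; split; apply/eqP; ring.
Qed.

Lemma quat_expand W : W = \sum_(a < 4) mcoef W a *: quat a.
Proof.
apply/matrixP => i j; rewrite sum4 !mxE !quatE !inord4K !mxE !mcoefE -?val_eqE.
have h2 : 2^-1 = (2^-1)%:C :> C by rewrite fmorphV rmorph_nat.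
rewrite h2; elim/forall2: i; elim/forall2: j; rewrite /= !inordK //=;
move: (W (inord 0) (inord 0)) (W (inord 0) (inord 1)) => [p p'] [q q'];
move: (W (inord 1) (inord 0)) (W (inord 1) (inord 1)) => [s s'] [t t'];
apply/eqP; rewrite eq_complex /=; apply/andP; split; apply/eqP; lra.
Qed.

Lemma unitary2_rows (W : 'M[C]_2) : unitary W -> forall i j,
  W i (inord 0) * (W j (inord 0))^*%C + W i (inord 1) * (W j (inord 1))^*%C =
  (i == j)%:R.
Proof. by move=> /matrixP hW i j; have := hW i j; rewrite !mxE sum2 !mxE. Qed.

Lemma unitary2_cols (W : 'M[C]_2) : unitary W -> forall i j,
  (W (inord 0) i)^*%C * W (inord 0) j + (W (inord 1) i)^*%C * W (inord 1) j =
  (i == j)%:R.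
Proof.
by move=> /mulmx1C/matrixP hW i j; have := hW i j; rewrite !mxE sum2 !mxE.
Qed.

(** A 2 by 2 unitary is a phase times an element of SU(2), and SU(2) consists of real combinations
    of [quat]; so all coefficients share a phase up to sign. In terms of products of entries, this
    is a linear consequence of the orthonormality of rows and columns. *)
Lemma mcoef_real W a b : unitary W ->
  complex.Im (mcoef W a * (mcoef W b)^*%C) = 0.
Proof.
move=> hW; have hr := unitary2_rows hW; have hc := unitary2_cols hW.
have h2 : 2^-1 = (2^-1)%:C :> C by rewrite fmorphV rmorph_nat.
have := hc (inord 0) (inord 0); have := hc (inord 0) (inord 1).
have := hc (inord 1) (inord 1); have := hr (inord 0) (inord 0).
have := hr (inord 0) (inord 1); have := hr (inord 1) (inord 1).
rewrite -!val_eqE /= !inordK //=.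
elim/forall4: a; elim/forall4: b; rewrite !mcoefE h2;
move: (W (inord 0) (inord 0)) (W (inord 0) (inord 1)) => [p p'] [q q'];
move: (W (inord 1) (inord 0)) (W (inord 1) (inord 1)) => [s s'] [t t'];
by do 6!(case => ? ?) => /=; lra.
Qed.

Lemma mcoef_sqnorm W : unitary W -> \sum_(a < 4) cabs (mcoef W a) ^+ 2 = 1.
Proof.
move=> hW; have hr := unitary2_rows hW.
have h2 : 2^-1 = (2^-1)%:C :> C by rewrite fmorphV rmorph_nat.
apply: complexI; rewrite rmorph_sum sum4 /= !sqr_cabs.
have := hr (inord 0) (inord 0); have := hr (inord 1) (inord 1).
rewrite -!val_eqE /= !inordK //= !mcoefE h2.
move: (W (inord 0) (inord 0)) (W (inord 0) (inord 1)) => [p p'] [q q'];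
move: (W (inord 1) (inord 0)) (W (inord 1) (inord 1)) => [s s'] [t t'].
case => h1 h1' [h3 h3']; apply/eqP; rewrite eq_complex /=.
by apply/andP; split; apply/eqP; lra.
Qed.

(** Phrased with products, so that neither the phase of [W] nor the sign of [r] matters; this is the
    form in which a Choi matrix determines [r]. *)
Definition mcoef_vector (W : 'M[C]_2) (r : 'I_4 -> RR) : Prop :=
  forall a b, mcoef W a * (mcoef W b)^*%C = (r a * r b)%:C.

(* Products of two coefficients are real, so dividing by the phase of any
   nonzero coefficient makes all of them real. *)
Lemma mcoef_vector_exists W : unitary W ->
  exists2 r, \sum_(a < 4) r a ^+ 2 = 1 & mcoef_vector W r.
Proof.
move=> hW; have h1 := mcoef_sqnorm hW.
have [c c0] : exists c, mcoef W c != 0.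
  apply/existsP; rewrite -negb_forall; apply/negP => /forallP h.
  move: h1; rewrite big1 => [|a _]; first by move/eqP; rewrite eq_sym oner_eq0.
  by rewrite (eqP (h a)) (cabs_real 0) normr0 expr0n.
pose n := cabs (mcoef W c).
have hn : (n ^+ 2)%:C = mcoef W c * (mcoef W c)^*%C by exact: sqr_cabs.
have n0 : n%:C != 0 :> C.
  apply: contraNneq c0 => hn0; move: hn; rewrite rmorphXn /= hn0 expr0n /=.
  by move/esym/eqP; rewrite mulf_eq0 conjc_eq0 orbb.
have cc0 : (mcoef W c)^*%C != 0 by rewrite conjc_eq0.
pose r a := complex.Re (mcoef W a * (mcoef W c)^*%C) / n.
have hr a : mcoef W a * (mcoef W c)^*%C = (r a)%:C * n%:C.
  rewrite -rmorphM /= divfK; last by apply: contraNneq n0 => ->.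
  have := mcoef_real a c hW; case: (_ * _) => x y /= -> //.
have hra a : mcoef W a = (r a)%:C * (n%:C / (mcoef W c)^*%C).
  by rewrite mulrA -hr mulfK.
pose z := n%:C / (mcoef W c)^*%C.
have hz : z * z^*%C = 1.
  rewrite /z conjcM conjc_inv conjcK (_ : n%:C^*%C = n%:C); last exact: conjc_real.
  rewrite mulrACA -invfM [X in X^-1]mulrC -hn -rmorphM -expr2 mulfV //.
  by rewrite rmorphXn expf_neq0.
have hv : mcoef_vector W r.
  move=> a b; rewrite (hra a) (hra b) -/z conjcM mulrACA hz mulr1.
  have -> : (r b)%:C^*%C = (r b)%:C by exact: conjc_real.
  by apply/esym/rmorphM.
exists r => //; rewrite -h1; apply: eq_bigr => a _; apply: complexI.
by rewrite sqr_cabs hv expr2.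
Qed.

(** * Choi matrices and overlaps in quaternion coordinates *)

Lemma uchanM U V rho : uchan U (uchan V rho) = uchan (U *m V) rho.
Proof. by rewrite /uchan dagM !mulmxA. Qed.

Lemma idtensor_ext F G X : F =1 G -> idtensor F X = idtensor G X.
Proof. by move=> h; apply/matrixP => i j; rewrite !mxE h. Qed.

Lemma Omega_omega : Omega *m adj Omega = 2 *: (omega *m adj omega).
Proof.
have -> : omega = isq2 *: Omega by [].
rewrite dagZ isq2_conj -scalemxAl -scalemxAr !scalerA -mulrA isq2_sqr.
by rewrite divff ?pnatr_eq0 // scale1r.
Qed.

Lemma dot_magic W a : dot (magic a) (lift2 W *m omega) = mcoef W a.
Proof. by rewrite magic_quat dot_lift2_omega. Qed.

(** Half the Choi operator of [uchan W] is the projector onto the vectorization of [W]. *)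
Lemma toMB_choi Phi W a b : Phi =1 uchan W ->
  ((2^-1)%:C *: toMB (choi Phi)) a b = mcoef W a * (mcoef W b)^*%C.
Proof.
move=> h; rewrite mxE mxE /choi (idtensor_ext _ h) Omega_omega idtensor_uchan.
rewrite -scalemxAr -scalemxAl -idtensor_uchan idtensor_uchan_omega.
rewrite -scalemxAr -scalemxAl mxE mulrA.
have -> : (2^-1)%:C * 2 = 1 :> C.
  by rewrite fmorphV rmorph_nat mulVf ?pnatr_eq0.
by rewrite mul1r -!dot_magic dot_outer.
Qed.

(** [A] cancels under the trace, leaving the inner product of the coefficients of [U A^+] and
    [V A^+]; their phases disappear in the squared modulus. *)
Lemma overlap_mcoef U V A (r e : 'I_4 -> RR) : unitary A ->
  mcoef_vector (U *m adj A) e -> mcoef_vector (V *m adj A) r ->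
  overlap U V = (\sum_(a < 4) r a * e a) ^+ 2.
Proof.
move=> hA he hr; apply: complexI; rewrite sqr_overlap.
have -> : \tr (adj U *m V) = \tr (adj (U *m adj A) *m (V *m adj A)).
  rewrite dagM dagK -!mulmxA [RHS]mxtrace_mulC -!mulmxA.
  by rewrite (mulmx1C hA) mulmx1.
have -> : 2^-1 * \tr (adj (U *m adj A) *m (V *m adj A)) =
    \sum_(a < 4) (mcoef (U *m adj A) a)^*%C * mcoef (V *m adj A) a.
  rewrite {1}[U *m adj A]quat_expand.
  have -> : adj (\sum_(a < 4) mcoef (U *m adj A) a *: quat a) =
      \sum_(a < 4) (mcoef (U *m adj A) a)^*%C *: adj (quat a).
    by rewrite !sum4 !dagD !dagZ.
  rewrite mulmx_suml raddf_sum mulr_sumr; apply: eq_bigr => a _ /=.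
  by rewrite -scalemxAl mxtraceZ mulrCA.
have -> : (\sum_(a < 4) (mcoef (U *m adj A) a)^*%C * mcoef (V *m adj A) a)^*%C =
    \sum_(a < 4) mcoef (U *m adj A) a * (mcoef (V *m adj A) a)^*%C.
  transitivity (\sum_(a < 4)
      ((mcoef (U *m adj A) a)^*%C * mcoef (V *m adj A) a)^*%C).
    exact: rmorph_sum.
  by apply: eq_bigr => a _; rewrite conjcM conjcK.
rewrite expr2 !mulr_suml rmorph_sum; apply: eq_bigr => a _ /=.
rewrite !mulr_sumr rmorph_sum; apply: eq_bigr => b _ /=.
transitivity ((mcoef (V *m adj A) a * (mcoef (V *m adj A) b)^*%C) *
  (mcoef (U *m adj A) b * (mcoef (U *m adj A) a)^*%C)); first by ring.
rewrite hr he; transitivity (((r a * r b) * (e b * e a))%:C).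
  by apply/esym/rmorphM.
by congr (_ %:C); ring.
Qed.

Lemma overlap_mcoef0 U A (r : 'I_4 -> RR) :
  mcoef_vector (U *m adj A) r -> overlap A U = r (inord 0) ^+ 2.
Proof.
move=> hr; apply: complexI; rewrite sqr_overlap expr2 -hr /mcoef quatE inord4K.
by rewrite dag1 mul1mx mxtrace_mulC.
Qed.

(** * Pauli channels *)

Lemma pauliE a : (pauli a = match val a with
  | 0 => 1%:M
  | 1 => \matrix_(i < 2, j < 2) nth 0 (nth [::] [:: [:: 0; 1]; [:: 1; 0]] i) j
  | 2 => \matrix_(i < 2, j < 2) nth 0 (nth [::] [:: [:: 0; - 'i%C]; [:: 'i%C; 0]] i) j
  | _ => \matrix_(i < 2, j < 2) nth 0 (nth [::] [:: [:: 1; 0]; [:: 0; -1]] i) j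
  end)%R.
Proof. by []. Qed.

Lemma adj_pauli a : adj (pauli a) = pauli a.
Proof.
rewrite pauliE; elim/forall4: a; rewrite inord4K ?dag1 //;
  apply/matrixP => i j; rewrite !mxE; elim/forall2: i; elim/forall2: j;
  rewrite !inordK //=; apply/eqP; rewrite eq_complex /=;
  by apply/andP; split; apply/eqP; ring.
Qed.

Lemma pauli_sqr a : pauli a *m pauli a = 1%:M.
Proof.
rewrite pauliE; elim/forall4: a; rewrite inord4K ?mulmx1 //;
  apply/matrixP => i j; rewrite !mxE sum2 !mxE -val_eqE;
  elim/forall2: i; elim/forall2: j;
  rewrite /= !inordK //=; apply/eqP; rewrite eq_complex /=;
  by apply/andP; split; apply/eqP; ring.
Qed.

Lemma pauli_unitary a : unitary (pauli a).
Proof. by rewrite /unitary adj_pauli pauli_sqr. Qed.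

Lemma tr_pauli a : 2^-1 * \tr (pauli a) = (a == ord0)%:R.
Proof.
rewrite -val_eqE /=; elim/forall4: a; rewrite !inordK // pauliE inord4K.
  by rewrite mxtrace1 mulVf ?pnatr_eq0.
all: rewrite /mxtrace sum2 !mxE !inordK //=.
- by rewrite addr0 mulr0.
- by rewrite addr0 mulr0.
- by rewrite subrr mulr0.
Qed.

Lemma quat_conj a rho : quat a *m rho *m adj (quat a) =
  pauli (inord (nth 0 [:: 0; 3; 1; 2] a)) *m rho *m
  pauli (inord (nth 0 [:: 0; 3; 1; 2] a)).
Proof.
have hz (z : C) (P : 'M[C]_2) : z * z^*%C = 1 ->
    (z *: P) *m rho *m adj (z *: P) = P *m rho *m adj P.
  by move=> h; rewrite dagZ -!scalemxAl -scalemxAr scalerA h scale1r.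
elim/forall4: a; rewrite /quat inord4K !inordK //=.
  by rewrite pauliE inord4K dag1.
all: rewrite hz ?adj_pauli //; apply/eqP; rewrite eq_complex /=.
all: by apply/andP; split; apply/eqP; ring.
Qed.

Lemma uchan_quat W rho : uchan W rho = \sum_(a < 4) \sum_(b < 4)
  (mcoef W a * (mcoef W b)^*%C) *: (quat a *m rho *m adj (quat b)).
Proof.
have hadj : adj W = \sum_(b < 4) (mcoef W b)^*%C *: adj (quat b).
  by rewrite {1}[W]quat_expand !sum4 !dagD !dagZ.
rewrite /uchan hadj {1}[W]quat_expand !mulmx_suml; apply: eq_bigr => a _.
rewrite mulmx_sumr; apply: eq_bigr => b _.
by rewrite -!scalemxAl -scalemxAr scalerA.
Qed.

Lemma Erem_sum p U Uhat rho :
  Erem p U Uhat rho = \sum_(j < 7) (p j)%:C *: uchan (U j *m adj Uhat) rho.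
Proof.
by rewrite /Erem /qcomp /qmix; apply: eq_bigr => j _; rewrite uchanM.
Qed.

Lemma pauli_channel_of_weights p U Uhat (r : 'I_7 -> 'I_4 -> RR) :
  (forall j, 0 <= p j) -> (forall j, mcoef_vector (U j *m adj Uhat) (r j)) ->
  (forall a b, a != b -> \sum_(j < 7) p j * (r j a * r j b) = 0) ->
  is_pauli_channel (Erem p U Uhat).
Proof.
move=> p0 hr hoff.
pose d a := \sum_(j < 7) p j * r j a ^+ 2.
have d0 a : 0 <= d a.
  by apply: sumr_ge0 => j _; rewrite mulr_ge0 ?sqr_ge0.
(* The list is the inverse of the permutation [[:: 0; 3; 1; 2]] by which [quat_conj] sends
   quaternion indices to Pauli indices. *)
exists (fun a => d (inord (nth 0 [:: 0; 2; 3; 1] a))); split=> // rho.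
transitivity (\sum_(a < 4) (d a)%:C *: (quat a *m rho *m adj (quat a))).
  rewrite Erem_sum.
  under eq_bigr => j _ do rewrite uchan_quat scaler_sumr.
  rewrite exchange_big; apply: eq_bigr => a _ /=.
  under eq_bigr => j _ do rewrite scaler_sumr.
  rewrite exchange_big (bigD1 a) //= [X in _ + X]big1 ?addr0.
    rewrite /d rmorph_sum scaler_suml; apply: eq_bigr => j _ /=.
    by rewrite hr scalerA -rmorphM expr2.
  move=> b ba.
  transitivity ((\sum_(j < 7) p j * (r j a * r j b))%:C *:
      (quat a *m rho *m adj (quat b))).
    rewrite rmorph_sum scaler_suml; apply: eq_bigr => j _ /=.
    by rewrite hr scalerA -rmorphM.
  by rewrite hoff 1?eq_sym // scale0r.
have hq (k l : nat) : (k < 4)%N -> nth 0%N [:: 0; 3; 1; 2]%N k = l ->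
    quat (inord k) *m rho *m adj (quat (inord k)) =
    pauli (inord l) *m rho *m pauli (inord l).
  by move=> hk hl; rewrite quat_conj inordK // hl.
have hd (k l : nat) : (k < 4)%N -> nth 0%N [:: 0; 2; 3; 1]%N k = l ->
    d (inord (nth 0%N [:: 0; 2; 3; 1]%N (inord k : 'I_4))) = d (inord l).
  by move=> hk hl; rewrite inordK // hl.
rewrite !sum4 (hq 0 0 isT erefl) (hq 1 3 isT erefl) (hq 2 1 isT erefl) (hq 3 2 isT erefl).
rewrite (hd 0 0 isT erefl) (hd 1 2 isT erefl) (hd 2 3 isT erefl) (hd 3 1 isT erefl).
move: (_ *: _) (_ *: _) (_ *: _) (_ *: _) => x y z t.
by rewrite -!addrA; congr (_ + _); rewrite [LHS]addrC addrA.
Qed.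

(** The left side depends only on the map [F], so any two decompositions of [F] into unitary
    channels have the same weighted overlap with the identity. *)
Lemma weights_overlap (I : finType) (w : I -> RR) (Vs : I -> 'M[C]_2) F :
  (forall rho, F rho = \sum_i (w i)%:C *: uchan (Vs i) rho) ->
  dot omega (idtensor F (omega *m adj omega) *m omega) =
  (\sum_i w i * overlap 1%:M (Vs i))%:C.
Proof.
move=> hF; pose u i := lift2 (Vs i) *m omega.
have ho i : dot omega (u i) = 2^-1 * \tr (adj 1%:M *m Vs i).
  by rewrite /u -dot_lift2_omega lift2_1 mul1mx.
have -> : idtensor F (omega *m adj omega) =
    \sum_i (w i)%:C *: (u i *m adj (u i)).
  rewrite (idtensor_wsum _ (Fs := fun i => uchan (Vs i)) hF).
  by apply: eq_bigr => i _; rewrite idtensor_uchan_omega.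
clearbody u; move: omega ho => o ho.
rewrite /dot mulmxA mulmx_sumr mulmx_suml summxE rmorph_sum.
apply: eq_bigr => i _ /=; rewrite -scalemxAr -scalemxAl mxE dot_outer.
by rewrite ho -sqr_overlap; apply/esym/rmorphM.
Qed.

Lemma overlap1 V A : overlap 1%:M (V *m adj A) = overlap A V.
Proof. by rewrite /overlap dag1 mul1mx mxtrace_mulC. Qed.

(** Evaluating at the identity matrix gives the sum of [chi]. Comparing the two decompositions by
    [weights_overlap] gives the second claim, since the Paulis other than the identity have trace
    0. *)
Lemma pauli_channel_coefs p U Uhat chi : unitary Uhat ->
  (forall j, unitary (U j)) -> prob7 p ->
  (forall rho, Erem p U Uhat rho =
     \sum_(a < 4) (chi a)%:C *: (pauli a *m rho *m pauli a)) ->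
  \sum_(a < 4) chi a = 1 /\
  chi ord0 = \sum_(j < 7) p j * overlap Uhat (U j).
Proof.
move=> hA hU [p0 p1] hE.
have hP rho : Erem p U Uhat rho = \sum_(a < 4) (chi a)%:C *: uchan (pauli a) rho.
  by rewrite hE; apply: eq_bigr => a _; rewrite /uchan adj_pauli.
split.
  have := hP 1%:M; rewrite Erem_sum.
  have -> : \sum_(j < 7) (p j)%:C *: uchan (U j *m adj Uhat) 1%:M = 1%:M.
    transitivity (\sum_(j < 7) (p j)%:C *: (1%:M : 'M[C]_2)).
      apply: eq_bigr => j _; congr (_ *: _); rewrite /uchan mulmx1.
      exact: unitaryM (hU j) (unitary_adj hA).
    by rewrite -scaler_suml -rmorph_sum p1 scale1r.
  have -> : \sum_(a < 4) (chi a)%:C *: uchan (pauli a) 1%:M =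
      (\sum_(a < 4) chi a)%:C *: (1%:M : 'M[C]_2).
    rewrite rmorph_sum scaler_suml; apply: eq_bigr => a _; congr (_ *: _).
    by rewrite /uchan mulmx1; apply: pauli_unitary.
  move=> /matrixP /(_ ord0 ord0); rewrite !mxE eqxx mulr1 => h.
  by apply: complexI; rewrite -h.
have := weights_overlap hP; rewrite (weights_overlap (Erem_sum p U Uhat)).
move=> /complexI h; transitivity (\sum_(a < 4) chi a * overlap 1%:M (pauli a)).
  rewrite (bigD1 ord0) //= [X in _ + X]big1 ?addr0 => [|a /negPf a0].
    by rewrite /overlap dag1 mul1mx tr_pauli eqxx (cabs_real 1) normr1 expr1n mulr1.
  by rewrite /overlap dag1 mul1mx tr_pauli a0 (cabs_real 0) normr0 expr0n mulr0.
by rewrite -h; apply: eq_bigr => j _; rewrite overlap1.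
Qed.

(** The identity component of the remnant cancels against [Uhat]. What remains is a difference of
    two positive combinations of unitary channels, each of total weight [1 - chi_II]. *)
Lemma dnorm_pauli_le p U Uhat chi : unitary Uhat ->
  (forall a, 0 <= chi a) -> \sum_(a < 4) chi a = 1 ->
  (forall rho, Erem p U Uhat rho =
     \sum_(a < 4) (chi a)%:C *: (pauli a *m rho *m pauli a)) ->
  dnorm (qsub (uchan Uhat) (qmix p U)) <= 2 * (1 - chi ord0).
Proof.
move=> hA c0 c1 hE.
have hc : \sum_(a < 4 | a != ord0) chi a = 1 - chi ord0.
  by rewrite -c1 [in RHS](bigD1 ord0) //= [_ + \sum_(_ < _ | _) _]addrC addrK.
have h0 : 0 <= 1 - chi ord0 by rewrite -hc; apply: sumr_ge0.
apply: dnorm_le => [X|]; last by rewrite mulr_ge0.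
have hmix rho : qmix p U rho =
    \sum_(a < 4) (chi a)%:C *: uchan (pauli a *m Uhat) rho.
  transitivity (Erem p U Uhat (uchan Uhat rho)).
    by rewrite /Erem /qcomp uchanM (mulmx1C hA) /uchan dag1 mul1mx mulmx1.
  rewrite hE; apply: eq_bigr => a _; rewrite -uchanM.
  by rewrite {2}/uchan adj_pauli.
rewrite idtensor_sub (idtensor_wsum X (Fs := fun a => uchan (pauli a *m Uhat)) hmix).
have -> : idtensor (uchan Uhat) X -
    \sum_(a < 4) (chi a)%:C *: idtensor (uchan (pauli a *m Uhat)) X =
  (1 - chi ord0)%:C *: idtensor (uchan Uhat) X -
    \sum_(a < 4 | a != ord0) (chi a)%:C *: idtensor (uchan (pauli a *m Uhat)) X.
  rewrite (bigD1 ord0) //= {1}/pauli mul1mx opprD addrA; congr (_ - _).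
  by rewrite rmorphB scalerBl scale1r.
have hU V : unitary V -> trnorm (idtensor (uchan V) X) <= trnorm X.
  by move=> hV; apply: trnorm_uchan.
apply: le_trans (trnormB _ _) _; rewrite mulrDl mulrDl mul1r.
apply: lerD.
  apply: le_trans (trnormZ _ _) _; rewrite cabs_real ger0_norm //.
  by apply: ler_wpM2l => //; apply: hU.
rewrite -hc; apply: trnorm_wsum => // a.
by apply: hU; apply: unitaryM => //; apply: pauli_unitary.
Qed.

Theorem theoremS1 :
  exists (c eps0 : RR) (v : 'I_7 -> 'I_3 -> RR),
    0 < c /\ 0 < eps0 /\ (forall j, unit3 (v j)) /\
    forall (Uhat : 'M[C]_2) (eps : RR) (Uh U : 'I_7 -> 'M[C]_2),
      unitary Uhat ->
      0 < eps -> eps <= eps0 ->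
      (forall j, unitary (Uh j)) ->
      (forall j, (2^-1)%:C *: toMB (choi (qcomp (uchan (Uh j)) (uchan (adj Uhat))))
                 = \matrix_(a < 4, b < 4)
                     (ehat c eps (v j) a * ehat c eps (v j) b)%:C) ->
      (forall j, unitary (U j)) ->
      (forall j, 2^-1 * dnorm (qsub (uchan (Uh j)) (uchan (U j))) <= eps) ->
      (exists p, prob7 p /\ is_pauli_channel (Erem p U Uhat)) /\
      (forall p, prob7 p -> is_pauli_channel (Erem p U Uhat) ->
         (forall q, prob7 q -> is_pauli_channel (Erem q U Uhat) ->
            2^-1 * dnorm (qsub (uchan Uhat) (qmix p U))
              <= 2^-1 * dnorm (qsub (uchan Uhat) (qmix q U))) ->
         ((c - 1) * eps) ^+ 2 <= 2^-1 * dnorm (qsub (uchan Uhat) (qmix p U)) /\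
         2^-1 * dnorm (qsub (uchan Uhat) (qmix p U)) <= ((c + 1) * eps) ^+ 2).
Proof.
(* This value brings the feature error [72 / c] below 1/1000, and [eps0 = c^-3] provides the
   hypothesis [c^3 eps <= 1] of [feature_close]. The body of [c] is then cleared to keep the numeral
   out of later arithmetic. *)
pose c : RR := 10 ^+ 5; have hc : 10 ^+ 5 <= c by [].
have c1 : 1 <= c by apply: le_trans hc; lra.
clearbody c.
have c0 : 0 < c by lra.
exists c, (c ^+ 3)^-1, dir; split=> //.
split; first by rewrite invr_gt0 exprn_gt0.
split; first exact: dir_unit.
move=> Uhat eps Uh U hA e0 he hUh hJ hU hd.
have ce : c ^+ 3 * eps <= 1 by rewrite -ler_pdivlMl ?mulr1 ?exprn_gt0.
have ce1 : c * eps <= 1.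
  apply: le_trans ce; rewrite ler_pM2r // -[X in X <= _]expr1.
  exact: ler_weXn2l.
have hW j : unitary (U j *m adj Uhat) := unitaryM (hU j) (unitary_adj hA).
have hh j : mcoef_vector (Uh j *m adj Uhat) (ehat c eps (dir j)).
  move=> a b; rewrite -(@toMB_choi (qcomp (uchan (Uh j)) (uchan (adj Uhat)))).
    by rewrite hJ mxE.
  by move=> rho; apply: uchanM.
have [r r1 hr] := fin_all_exists2 (fun j => mcoef_vector_exists (hW j)).
have hx j : 1 - eps ^+ 2 <= (\sum_(a < 4) r j a * ehat c eps (dir j) a) ^+ 2.
  rewrite -(overlap_mcoef hA (hh j) (hr j)).
  have := le_trans (dnorm_uchan_ge (hUh j) (hU j)) (_ : _ <= 2 * eps).
  have := hd j; rewrite mulrC ler_pdivrMr // mulrC => -> /(_ isT).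
  rewrite ler_pM2l // => h; set o := overlap _ _ in h *.
  (* A negative [1 - o] would be hidden by the square root, but then the claim is immediate. *)
  have [o1|o1] := leP 0 (1 - o); last by have := sqr_ge0 eps; lra.
  have : 1 - o <= eps ^+ 2.
    by rewrite -(sqr_sqrtr o1) ler_sqr ?nnegrE ?sqrtr_ge0 ?(ltW e0).
  lra.
split.
  have [p hp hoff] := diagonalizing_weights hc e0 ce r1 hx.
  exists p; split=> //; apply: pauli_channel_of_weights hr hoff.
  by case: hp.
move=> p hp [chi [chi0 hchi]] _.
have [chi1 chiE] := pauli_channel_coefs hA hU hp hchi.
have hup := dnorm_pauli_le hA chi0 chi1 hchi.
have hlo := dnorm_mix_ge hA hU hp.
have hov : 1 - chi ord0 = \sum_(j < 7) p j * (1 - r j (inord 0) ^+ 2).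
  rewrite chiE -[X in X - _ = _]hp.2 -sumrB; apply: eq_bigr => j _.
  by rewrite (overlap_mcoef0 (hr j)) mulrBr mulr1.
have hb j := sine_bounds (dir_unit j) c1 (ltW e0) ce1 (r1 j) (hx j).
(* Writing each bound as a [p]-average lets the bounds on [1 - r_j0^2] be averaged termwise. *)
have hcst (x : RR) : x = \sum_(j < 7) p j * x by rewrite -mulr_suml hp.2 mul1r.
have hl : ((c - 1) * eps) ^+ 2 <= 1 - chi ord0.
  rewrite hov [X in X <= _]hcst; apply: ler_sum => j _.
  by apply: ler_wpM2l; [case: hp | case/andP: (hb j)].
have hu : 1 - chi ord0 <= ((c + 1) * eps) ^+ 2.
  rewrite hov [X in _ <= X]hcst; apply: ler_sum => j _.
  by apply: ler_wpM2l; [case: hp | case/andP: (hb j)].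
move: hup hlo; rewrite -chiE; move: (dnorm _) => D hup hlo.
by split; lra.
Qed.
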